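(* Assume the loss is bounded: $\ell(z,\xi)\in[\underline\ell,\overline\ell]$ for all $z\in\mathcal X$ and $\xi\in\Xi$. Let $\hat\xi_1,\dots,\hat\xi_N$ be a sample trajectory of a Markov chain with invariant distribution $\mathbb P^\star$. Suppose that the Markov chain is time-homogeneous with an absolute spectral gap of $1-\lambda>0$, where $\lambda\in[0,1)$ is the operator norm of the Markov transition kernel acting on the Hilbert space of square-integrable mean-zero functions under $\mathbb P^\star$. Then, for every fixed $z\in\mathcal X$, the pointwise concentration inequality $$\mathbb E_{\mathbb P^\star}[\ell(z,\xi)]-\mathbb E_{\hat{\mathbb P}_N}[\ell(z,\xi)]\le\frac1{\sqrt N}\,\varepsilon\!\left(\log\frac1\delta\right)\quad\text{with probability at least }1-\delta$$ holds with $\varepsilon(y)=\frac{\overline\ell-\underline\ell}{2}\sqrt{\frac{2(1+\lambda)}{1-\lambda}\,y}$, i.e., $$\mathbb E_{\mathbb P^\star}[\ell(z,\xi)]-\mathbb E_{\hat{\mathbb P}_N}[\ell(z,\xi)]\le\frac1{\sqrt N}\,\frac{\overline\ell-\underline\ell}{2}\sqrt{\frac{2(1+\lambda)}{1-\lambda}\log\frac1\delta}$$ with probability at least $1-\delta$. The same result holds for time-inhomogeneous chains with $\lambda$ replaced by $\max_{i\in[N]}\lambda_i$, where $1-\lambda_i$ is the spectral gap of the Markov transition kernel for step $i$.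
   Context: $\mathcal X\subseteq\mathbb R^{D_x}$ is a compact convex decision set, $\Xi\subseteq\mathbb R^{D_\xi}$ is the support of the uncertain parameter $\xi$, and $\ell(x,\xi)=\max_{j\in[J]}\big(a_j(x)^\top\xi+b_j(x)\big)$ with $a_j,b_j$ affine in $x$; $[N]=\{1,\dots,N\}$. $\hat{\mathbb P}_N$ is the empirical distribution of the trajectory, so $\mathbb E_{\hat{\mathbb P}_N}[\ell(z,\xi)]=\frac1N\sum_{i=1}^N\ell(z,\hat\xi_i)$; probability refers to the trajectory. $\mathbb E_{\mathbb P^\star}[\ell(z,\xi)]$ is the expectation under the invariant distribution $\mathbb P^\star$. $\delta\in(0,1)$ is the confidence parameter.
   Formalization: The Markov chain is taken to be stationary: the first sample is assumed to be distributed according to the invariant distribution; for an arbitrary initial law the stated bound fails (e.g. one sample fixed at a low-loss point and delta near 1). *)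

(* Defs.v *)
From HB Require Import structures.
From mathcomp Require Import all_boot all_order all_algebra.
From mathcomp Require Import all_classical all_reals all_analysis.

Set Implicit Arguments.
Unset Strict Implicit.
Unset Printing Implicit Defensive.

Import Order.TTheory GRing.Theory Num.Theory.
Import numFieldNormedType.Exports.

Local Open Scope classical_set_scope.
Local Open Scope ring_scope.

(* R^D with its Borel sigma-algebra (carrier: column vectors). *)
Notation borelV R D := (g_sigma_algebraType (@open 'cV[R]_D)).

Definition affine (R : realType) (U V : lmodType R) (f : U -> V) : Prop :=
  exists (L : {linear U -> V}) (c : V), forall x, f x = L x + c.

Section Loss.
Context {R : realType} {Dx Dxi J : nat}.
Variables (a : 'I_J.+1 -> 'cV[R]_Dx -> 'cV[R]_Dxi) (b : 'I_J.+1 -> 'cV[R]_Dx -> R).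

Definition loss_piece (j : 'I_J.+1) (x : 'cV[R]_Dx) (xi : 'cV[R]_Dxi) : R :=
  ((a j x)^T *m xi) ord0 ord0 + b j x.

(* There are J.+1 >= 1 pieces; starting the maximum from one of them makes it
   the genuine maximum of the finite family. *)
Definition loss (x : 'cV[R]_Dx) (xi : 'cV[R]_Dxi) : R :=
  \big[Num.max/loss_piece ord0 x xi]_(j < J.+1) loss_piece j x xi.

End Loss.

Section Kernels.
Context {d : measure_display} {T : measurableType d} {R : realType}.
Local Open Scope ereal_scope.

Definition invariant_law (k : R.-pker T ~> T) (mu : probability T R) : Prop :=
  forall A : set T, measurable A -> \int[mu]_x k x A = mu A.

Definition markov_op (k : R.-pker T ~> T) (f : T -> R) (x : T) : \bar R :=
  \int[k x]_y (f y)%:E.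

Definition L2_0 (mu : probability T R) : set (T -> R) :=
  [set f | f \in Lfun mu 2%:E /\ 'E_mu[f] = 0].

Definition opnorm_L2_0 (mu : probability T R) (k : R.-pker T ~> T) : \bar R :=
  ereal_sup [set 'N[mu]_(2%:E)[markov_op k f]
            | f in [set f | L2_0 mu f /\ 'N[mu]_(2%:E)[EFin \o f] <= 1]].

End Kernels.

Section Chains.
Context {d d' : measure_display} {Om : measurableType d} {T : measurableType d'}
  {R : realType}.
Variables (P : probability Om R) (N : nat).
Local Open Scope ereal_scope.

(* sigma(X_0, ..., X_i) *)
Definition past_sigma (X : 'I_N -> {mfun Om >-> T}) (i : 'I_N) : set (set Om) :=
  g_sigma_preimage (fun (j : 'I_i.+1) => (X (widen_ord (ltn_ord i) j) : Om -> T)).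

(* X_0, ..., X_(N-1) is a Markov chain with initial law mu whose step from X_i
   to X_(i+1) has kernel k i: k i (X_i) B is a version of the conditional
   probability of {X_(i+1) \in B} given sigma(X_0, ..., X_i).  The kernel
   k (N-1), which leads out of the trajectory, is unconstrained. *)
Definition markov_chain (mu : probability T R) (k : 'I_N -> R.-pker T ~> T)
    (X : 'I_N -> {mfun Om >-> T}) : Prop :=
  (forall i : 'I_N, i = 0%N :> nat ->
     forall B : set T, measurable B -> distribution P (X i) B = mu B) /\
  (forall i j : 'I_N, j = i.+1 :> nat ->
     forall (E : set Om) (B : set T), past_sigma X i E -> measurable B ->
       P (E `&` X j @^-1` B) = \int[P]_(w in E) k i (X i w) B).

Definition empirical_mean (X : 'I_N -> {mfun Om >-> T}) (f : T -> R) (w : Om) : R :=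
  (N%:R^-1 * \sum_(i < N) f (X i w))%R.

End Chains.

Definition eps_rate {R : realType} (lo hi lam y : R) : R :=
  (hi - lo) / 2 * Num.sqrt (2 * (1 + lam) / (1 - lam) * y).

(* Main.v *)
Require Import Defs.
From HB Require Import structures.
From mathcomp Require Import all_boot all_order all_algebra.
From mathcomp Require Import all_classical all_reals all_analysis.
From mathcomp Require Import measurable_realfun.
From mathcomp Require Import ring lra.

Set Implicit Arguments.
Unset Strict Implicit.
Unset Printing Implicit Defensive.

Import Order.TTheory GRing.Theory Num.Theory.
Import numFieldNormedType.Exports.

Local Open Scope classical_set_scope.
Local Open Scope ring_scope.

(** Markov's inequality reduces the claim to a bound on an exponential moment:
    for the centred function [g = t (E f - f)], which takes its values in an
    interval of length [t (hi - lo)],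
    [E exp (sum_i g(X_i)) <= r ^ N] with
    [r = exp ((1 + lambda) / (1 - lambda) * (t (hi - lo)) ^ 2 / 8)]
    ([chain_mgf_le]); optimising in [t] gives the stated rate.

    Put [w = exp (g / 2)], and let [K_i] be the operator of the i-th kernel.  By
    the Markov property and stationarity the exponential moment is
    [<w, (w K_0 w) ... (w K_(N-2) w) w>] in [L^2] of the invariant law, so
    it is enough that every [h |-> w K (w h)] has [L^2] norm at most [r]
    ([tilted_kernel_contraction], [tilted_chain_bound]).

    As [K] fixes the constants and contracts mean-zero functions by [lambda],
    Cauchy-Schwarz gives [<f, K h> ^ 2 <= Q f * Q h], where [Q] is the quadratic
    form of the Leon-Perron operator [lambda I + (1 - lambda) E]
    ([kernel_form_le]).  So [K] may be replaced by that operator, and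
    [w (lambda I + (1 - lambda) E) w] is a rank-one perturbation of the
    multiplication by [lambda exp g].  Cauchy-Schwarz with the weight
    [r - lambda exp g] shows that it is bounded by [r] as soon as
    [(1 - lambda) E (exp g / (r - lambda exp g)) <= 1] ([leon_perron_tilt]).

    The function [x |-> exp x / (r - lambda exp x)] is convex, hence lies below
    its chord over the range of [g]; since [g] is centred, the worst case is a
    law with two atoms ([resolvent_affine_majorant]).  In that case the
    requirement says that [r] is beyond the roots of the characteristic
    polynomial of a two-state chain.  With [u] the half-length of the range,
    [m] its asymmetry and [v = (1 + lambda) / (1 - lambda) * u ^ 2 / 2 + m u],
    this reads
    [exp v + lambda exp (- v) >= (1 + lambda) cosh u + (1 - lambda) m sinh u]
    ([two_state_characteristic_ge]).  When [m] is eliminated in favour of [v],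
    both sides are affine in [lambda], so the end points suffice: [lambda = 0] is
    the two-point case of Hoeffding's lemma ([two_point_mgf_le]), and
    [lambda = 1] follows from [2 cosh u <= 2 + u sinh u].

    Only bounded measurable functions occur.  The Markov property, given on
    events, is carried over to them by [eq_mixture].  The loss is bounded on
    the support only; it is truncated to [[lo, hi]], which changes nothing
    along almost every trajectory ([markov_hoeffding_support]). *)

(** * Exponential inequalities *)

Lemma ger0_is_derive_le (R : realType) (f df : R -> R) (x : R) :
  (forall y : R, is_derive y 1 f (df y)) -> (forall y, 0 <= y -> 0 <= df y) ->
  0 <= x -> f 0 <= f x.
Proof.
move=> fdf df0 x0.
have cf : {within `[0, x], continuous f}.
  by apply: derivable_within_continuous => y _; have := fdf y; case.
have [c /itvP cx E] := MVT_segment x0 (fun y _ => fdf y) cf.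
by rewrite -subr_ge0 E subr0 mulr_ge0// df0// cx.
Qed.

Section hyperbolic.
Context {R : realType}.
Implicit Types t : R.

(** This is [sinh t <= t cosh t], multiplied out to avoid the quotients: the
    derivative of [(1 + y) - exp (2 y) (1 - y)] is [1 - exp (2 y) (1 - 2 y)]. *)
Lemma sinh_le_mul_cosh t : 0 <= t -> expR t * (1 - t) <= expR (- t) * (1 + t).
Proof.
move=> t0.
pose f y : R := (1 + y) - expR (y + y) * (1 - y).
have : f 0 <= f t.
  apply: (@ger0_is_derive_le _ _ (fun y => 1 - expR (y + y) * (1 - (y + y)))) => //.
    move=> y; rewrite /f; apply: is_derive_eq.
    rewrite /GRing.scale/=; ring.
  move=> y y0; have := expR_ge1Dx (- (y + y)).
  rewrite expRN => h; have e0 := expR_gt0 (y + y).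
  by rewrite subr_ge0 -ler_pdivlMl// mulr1.
rewrite /f !addr0 expR0 subr0 mulr1 subrr expRD expRN => h.
have e0 := expR_gt0 t.
rewrite ler_pdivlMl//; nra.
Qed.
End hyperbolic.

Section two_point.
Context {R : realType}.
Implicit Types u m : R.

(** The derivative of the difference of the two sides is [u cosh u - sinh u]. *)
Lemma cosh_le_mul_sinh u : 0 <= u ->
  expR u + expR (- u) <= 2 + u * (expR u - expR (- u)) / 2.
Proof.
move=> u0.
pose f y : R := 2 + y * (expR y - expR (- y)) / 2 - (expR y + expR (- y)).
suff : f 0 <= f u by rewrite /f oppr0 expR0; lra.
apply: (@ger0_is_derive_le _ _ (fun y =>
    (expR (- y) * (1 + y) - expR y * (1 - y)) / 2)) => //.
  move=> y; rewrite /f; apply: is_derive_eq.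
  by rewrite /GRing.scale/=; field.
by move=> y /sinh_le_mul_cosh h; lra.
Qed.

(** Hoeffding's lemma for a two-point law, but for all real [m]: outside
    [[-1, 1]] the left-hand side can be negative, so the usual estimate of its
    logarithm is not available.  The difference [Q] of the two sides
    satisfies [Q'' >= Q] and vanishes to first order at 0; below, [h] is
    [exp u (Q' - Q)] and [f] is [exp (- u) Q] up to a constant. *)
Lemma two_point_mgf_le u m : 0 <= u ->
  (1 + m) / 2 * expR u + (1 - m) / 2 * expR (- u) <= expR (u ^+ 2 / 2 + m * u).
Proof.
move=> u0.
pose h y := expR (y ^+ 2 / 2 + (m + 1) * y) * (m + y - 1) + (1 - m).
have h0 y : 0 <= y -> 0 <= h y.
  move=> y0; suff : h 0 <= h y.
    by rewrite /h expr0n/= mul0r mulr0 !addr0 expR0; lra.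
  apply: (@ger0_is_derive_le _ _ (fun y =>
      expR (y ^+ 2 / 2 + (m + 1) * y) * (y + m) ^+ 2)) => //.
    move=> z; rewrite /h; apply: is_derive_eq.
    by rewrite /GRing.scale/=; field.
  by move=> z _; rewrite mulr_ge0// ?expR_ge0 ?sqr_ge0.
pose f y := expR (y ^+ 2 / 2 + (m - 1) * y) - (1 - m) / 2 * expR (- (y + y)).
suff : f 0 <= f u.
  rewrite /f expr0n/= mul0r mulr0 !addr0 oppr0 expR0 => fu.
  have -> : u ^+ 2 / 2 + m * u = u + (u ^+ 2 / 2 + (m - 1) * u) by ring.
  rewrite [leRHS]expRD. 
  have E2 : expR (- (u + u)) = expR (- u) * expR (- u).
    by rewrite -expRD; congr expR; ring.
  move: fu; rewrite {}E2.
  have := expRxMexpNx_1 u; have := expR_gt0 u.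
  move: (expR u) (expR (- u)) (expR (_ + _)) => e i X e0 ei /(ler_wpM2l (ltW e0)).
  have : (1 - m) / 2 * (e * i) * i = (1 - m) / 2 * i by rewrite ei mulr1.
  lra.
apply: (@ger0_is_derive_le _ _ (fun y => expR (- (y + y)) * h y)) => //.
  move=> y; rewrite /f /h; apply: is_derive_eq.
  rewrite /GRing.scale/=.
  have -> : expR (y ^+ 2 / 2 + (m + 1) * y) =
            expR (y ^+ 2 / 2 + (m - 1) * y) * expR (y + y).
    by rewrite -expRD; congr expR; ring.
  have -> : expR (y + y) = (expR (- (y + y)))^-1 by rewrite expRN invrK.
  have := expR_gt0 (- (y + y)) => e0.
  by field; rewrite gt_eqF.
by move=> y y0; rewrite mulr_ge0// ?expR_ge0// h0.
Qed.
End two_point.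

Section twostate.
Context {R : realType}.
Implicit Types u m t l : R.

(** Strictness comes from halving: with [T = tanh (t / 2)], one has
    [tanh t = 2 T / (1 + T ^ 2) < 2 T <= t]. *)
Lemma sinh_lt_mul_cosh t : 0 < t -> expR t * (1 - t) < expR (- t) * (1 + t).
Proof.
move=> t0; set s := t / 2; have s0 : 0 < s by rewrite divr_gt0.
have tE : t = s + s by rewrite /s; field.
have h := sinh_le_mul_cosh (ltW s0).
rewrite tE opprD !expRD.
have := expRxMexpNx_1 s; have := expR_gt0 s; have := expR_gt0 (- s).
move: (expR s) (expR (- s)) h => e i h i0 e0 ei.
have [s1|s1] := leP (1 - (s + s)) 0.
  apply: (@le_lt_trans _ _ 0); first by rewrite mulr_ge0_le0//; nra.
  by rewrite !mulr_gt0//; lra.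
have s1' : 0 < 1 - s by lra.
rewrite -(ltr_pM2l (_ : 0 < (1 - s) ^+ 2)) ?exprn_gt0//.
apply: (@le_lt_trans _ _ ((i * (1 + s)) ^+ 2 * (1 - (s + s)))).
  rewrite [leLHS](_ : _ = (e * (1 - s)) ^+ 2 * (1 - (s + s))); last by ring.
  by rewrite ler_pM2r// ler_sqr// nnegrE mulr_ge0 ?ltW//; lra.
rewrite -subr_gt0 [ltRHS](_ : _ = i ^+ 2 * (4 * s ^+ 3)); last by ring.
by rewrite !mulr_gt0// exprn_gt0.
Qed.

(** The exponent minus [u] is at least [- 2 (1 - l) / (1 + l)], its minimum over
    [u] for [m = -1], and [l < exp (- 2 (1 - l) / (1 + l))] because
    [l = (1 - t) / (1 + t)] and [tanh t < t] for [t = (1 - l) / (1 + l)]. *)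
Lemma expR_quad_gt l u m : 0 <= l -> l < 1 -> -1 <= m -> 0 <= u ->
  l * expR u < expR ((1 + l) / (1 - l) * u ^+ 2 / 2 + m * u).
Proof.
move=> l0 l1 m1 u0; pose t := (1 - l) / (1 + l).
have t0 : 0 < t by rewrite divr_gt0//; lra.
have lt_l : l < expR (- (t + t)).
  have := sinh_lt_mul_cosh t0.
  rewrite /t [1 - (1 - l) / _](_ : _ = 2 * l / (1 + l)); last by field; lra.
  rewrite [1 + (1 - l) / _](_ : _ = 2 / (1 + l)); last by field; lra.
  rewrite -/t opprD expRD expRN; move: (expR t) (expR_gt0 t) => e e0.
  have l2 : 0 < 2 / (1 + l) by rewrite divr_gt0//; lra.
  rewrite [2 * l / _](_ : _ = l * (2 / (1 + l))); last by field; lra.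
  by rewrite mulrA ltr_pM2r// mulrC -ltr_pdivlMr.
apply: (@lt_le_trans _ _ (expR (- (t + t)) * expR u)).
  by rewrite ltr_pM2r ?expR_gt0.
rewrite -expRD ler_expR -subr_ge0.
rewrite [X in _ <= X](_ : _ = ((u / t - 2) ^+ 2 * t / 2 + (m + 1) * u)).
  apply: addr_ge0; last by rewrite mulr_ge0//; lra.
  by rewrite divr_ge0// mulr_ge0 ?sqr_ge0// ltW.
by rewrite /t; field; lra.
Qed.

(** For fixed [u] and exponent [w], eliminating [m] makes both sides affine in
    [l]: the inequality is the combination, with weights [1 - l] and [l], of
    [two_point_mgf_le] (at the slope [m'] with [u ^ 2 / 2 + m' u = w]) and of
    [2 cosh w >= 2 >= 2 cosh u - u sinh u]. *)
Lemma two_state_characteristic_ge l u m : 0 <= l -> l < 1 -> 0 <= u ->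
  (1 + l) * ((expR u + expR (- u)) / 2) +
    (1 - l) * m * ((expR u - expR (- u)) / 2) <=
  expR ((1 + l) / (1 - l) * u ^+ 2 / 2 + m * u) +
    l * expR (- ((1 + l) / (1 - l) * u ^+ 2 / 2 + m * u)).
Proof.
move=> l0 l1; rewrite le_eqVlt => /predU1P[<-|u0].
  by rewrite expr0n/= !mulr0 mul0r addr0 oppr0 expR0; lra.
set w := _ + m * u.
(* the slope for which the two-point bound has exponent [w] *)
pose m' := (w - u ^+ 2 / 2) / u.
(* [w] determines [m] as well; substituting makes the claim affine in [l] *)
have -> : m = (1 - l)^-1 * ((1 - l) * m' - l * u).
  by rewrite /m' /w; field; rewrite subr_eq0 !gt_eqF.
have S2 := two_point_mgf_le m' (ltW u0).
rewrite (_ : u ^+ 2 / 2 + m' * u = w) in S2; last first.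
  by rewrite /m' addrC divfK ?gt_eqF// subrK.
have S1 := cosh_le_mul_sinh (ltW u0).
have S3 : 2 <= expR w + expR (- w).
  rewrite expRN; move: (expR w) (expR_gt0 w) => e e0.
  rewrite -subr_ge0 [leRHS](_ : _ = (e - 1) ^+ 2 / e); last first.
    by field; rewrite gt_eqF.
  by rewrite divr_ge0 ?sqr_ge0// ltW.
rewrite mulVKf; last by rewrite subr_eq0 gt_eqF.
have := ler_wpM2l l0 S1; have := ler_wpM2l l0 S3.
have l1' : 0 <= 1 - l by lra.
have := ler_wpM2l l1' S2; lra.
Qed.
End twostate.

(** * Reduction to a two-point law *)

Section resolvent.
Context {R : realType}.
Implicit Types a b l r s v x y : R.

Lemma expR_tangent x y : expR x * (1 + (y - x)) <= expR y.
Proof.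
have -> : expR y = expR x * expR (y - x) by rewrite -expRD addrC subrK.
by rewrite ler_pM2l ?expR_gt0// expR_ge1Dx.
Qed.

(** Convexity of [s |-> s / (r - l s)], in the form needed to combine it with
    that of the exponential: the graph is above each of its tangents. *)
Lemma ratio_tangent l r s v : 0 <= l -> 0 < r -> l * s < r -> l * v < r ->
  s / (r - l * s) + r / (r - l * s) ^+ 2 * (v - s) <= v / (r - l * v).
Proof.
move=> l0 r0; rewrite -subr_gt0 => ls; rewrite -subr_gt0 => lv.
rewrite -subr_ge0 [leRHS](_ : _ =
    r * l * (v - s) ^+ 2 / ((r - l * s) ^+ 2 * (r - l * v))); last first.
  by field; rewrite !gt_eqF.
apply: divr_ge0; apply: mulr_ge0; rewrite ?sqr_ge0 ?(ltW lv)//.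
by rewrite mulr_ge0// ltW.
Qed.

Lemma expR_ratio_chord l r a b x : 0 <= l -> 0 < r -> a < b -> a <= x <= b ->
  l * expR b < r ->
  expR x / (r - l * expR x) <=
  (b - x) / (b - a) * (expR a / (r - l * expR a)) +
  (x - a) / (b - a) * (expR b / (r - l * expR b)).
Proof.
move=> l0 r0 ab /andP[ax xb] lb.
have lxr y : y <= b -> l * expR y < r.
  by move=> yb; rewrite (le_lt_trans _ lb)// ler_wpM2l// ler_expR.
set p := (b - x) / (b - a); set q := (x - a) / (b - a).
have ba0 : 0 < b - a by rewrite subr_gt0.
have p0 : 0 <= p by rewrite divr_ge0 ?subr_ge0// ltW.
have q0 : 0 <= q by rewrite divr_ge0 ?subr_ge0// ltW.
have pq : p + q = 1 by rewrite /p /q; field; rewrite gt_eqF.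
have cx : expR x <= p * expR a + q * expR b.
  have := ler_wpM2l p0 (expR_tangent x a).
  have := ler_wpM2l q0 (expR_tangent x b).
  have -> : q * (expR x * (1 + (b - x))) =
      expR x - p * (expR x * (1 + (a - x))).
    by rewrite /p /q; field; rewrite gt_eqF.
  lra.
have la := lxr _ (ltW ab); have lx := lxr _ xb.
have := ler_wpM2l p0 (ratio_tangent l0 r0 lx la).
have := ler_wpM2l q0 (ratio_tangent l0 r0 lx lb).
set c := r / _ ^+ 2.
have c0 : 0 <= c by rewrite divr_ge0 ?sqr_ge0// ltW.
have := ler_wpM2l c0 cx.
have -> : p = 1 - q by rewrite -pq addrK.
lra.
Qed.

(** The majorant is the chord over [[a, b]].  Its value at 0 is the expectation
    under the centred law on [{a, b}] (signed if [b < 0]).  That this is at most 1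
    is the inequality between [r] and the characteristic polynomial of the
    two-state chain, after division by [exp ((a + b) / 2)]. *)
Lemma resolvent_affine_majorant l a b :
  0 <= l -> l < 1 -> a <= 0 -> a < b ->
  let r := expR ((1 + l) / (1 - l) * (b - a) ^+ 2 / 8) in
  exists s, forall x, a <= x <= b ->
    l * expR x < r /\ (1 - l) * (expR x / (r - l * expR x)) <= 1 + s * x.
Proof.
move=> l0 l1 a0 ab r.
pose u := (b - a) / 2; pose m := - (a + b) / (b - a).
have ba0 : 0 < b - a by rewrite subr_gt0.
have u0 : 0 <= u by rewrite divr_ge0// ltW.
have m1 : -1 <= m by rewrite /m ler_pdivlMr//; lra.
pose w := (1 + l) / (1 - l) * u ^+ 2 / 2 + m * u.
have gap := expR_quad_gt l0 l1 m1 u0; have tst := two_state_characteristic_ge m l0 l1 u0.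
rewrite -/w in gap tst.
pose c := expR ((a + b) / 2).
have c0 : 0 < c by exact: expR_gt0.
have rE : r = c * expR w.
  rewrite /c /r /w /m /u -expRD; congr expR; field.
  by rewrite gt_eqF//= subr_eq0 gt_eqF.
have aE : expR a = c * expR (- u) by rewrite -expRD; congr expR; rewrite /u; field.
have bE : expR b = c * expR u by rewrite -expRD; congr expR; rewrite /u; field.
have lb : l * expR b < r by rewrite rE bE mulrCA ltr_pM2l.
have r0 : 0 < r by exact: expR_gt0.
have lxr y : y <= b -> l * expR y < r.
  by move=> yb; rewrite (le_lt_trans _ lb)// ler_wpM2l// ler_expR.
have la := lxr _ (ltW ab).
pose N y := expR y / (r - l * expR y).
(* the slope of the chord, scaled by [1 - l] *)
exists ((1 - l) * (N b - N a) / (b - a)) => x xab.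
split; first by apply: lxr; case/andP: xab.
have l1' : 0 <= 1 - l by rewrite subr_ge0 ltW.
apply: le_trans (ler_wpM2l l1' (expR_ratio_chord l0 r0 ab xab lb)) _.
rewrite -/(N a) -/(N b).
suff : (1 - l) * (b / (b - a) * N a - a / (b - a) * N b) <= 1.
  rewrite -(lerD2r ((1 - l) * (N b - N a) / (b - a) * x)); apply: le_trans.
  rewrite le_eqVlt; apply/orP; left.
  by apply/eqP; move: (N a) (N b) => Na Nb; field; rewrite gt_eqF.
have -> : b / (b - a) = (1 - m) / 2 by rewrite /m; field; rewrite gt_eqF.
have -> : a / (b - a) = - ((1 + m) / 2) by rewrite /m; field; rewrite gt_eqF.
rewrite /N aE bE; rewrite rE aE bE in la lb *.
move: la lb; rewrite [l * (c * _)]mulrCA ltr_pM2l// => la.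
rewrite [l * (c * _)]mulrCA ltr_pM2l// => lb.
rewrite !expRN in tst la *.
have := expR_gt0 u; have := expR_gt0 w.
move: (expR u) (expR w) tst la lb => e z tst la lb z0 e0.
rewrite -subr_ge0 [leRHS](_ : _ = z * (z + l / z -
    ((1 + l) * ((e + e^-1) / 2) + (1 - l) * m * ((e - e^-1) / 2))) /
    ((z - l * e) * (z - l / e))).
  rewrite -subr_gt0 in la; rewrite -subr_gt0 in lb; rewrite -subr_ge0 in tst.
  by rewrite divr_ge0// mulr_ge0// ltW.
rewrite -subr_gt0 in la; rewrite -subr_gt0 in lb.
have ze : z * e - l != 0.
  by rewrite [z * e - l](_ : _ = e * (z - l / e)) ?mulf_neq0 ?gt_eqF//; field;
    rewrite gt_eqF.
field; rewrite ze (gt_eqF e0) (gt_eqF z0) (gt_eqF lb)/=.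
rewrite -mulrBr [c * z * e - _](_ : _ = c * (z * e - l)); last by ring.
by rewrite !mulf_neq0 ?(gt_eqF lb) ?(gt_eqF c0).
Qed.
End resolvent.

(** * Mixtures of measures *)

Section mixture.
Local Open Scope ereal_scope.
Context d d' (Om : measurableType d) (S : measurableType d') (R : realType).
Variable P : {measure set Om -> \bar R}.
Import HBNNSimple.

Section one_family.
Variables (K : Om -> {measure set S -> \bar R}) (G : Om -> R).
Hypothesis mK : forall U, measurable U -> measurable_fun [set: Om] (K ^~ U).
Hypothesis G0 : forall w, (0 <= G w)%R.
Hypothesis mG : measurable_fun [set: Om] G.

Lemma mixture_nnsfun (h : {nnsfun S >-> R}) :
  \int[P]_w ((G w)%:E * \int[K w]_y (h y)%:E) =
  \sum_(r \in range h) r%:E * \int[P]_w ((G w)%:E * K w (h @^-1` [set r])).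
Proof.
have rK0 r w : 0 <= r%:E * K w (h @^-1` [set r]).
  by apply: (mulemu_ge0 (fun r => h @^-1` [set r])); exact: preimage_nnfun0.
have mGK r : measurable_fun setT (fun w => (G w)%:E * K w (h @^-1` [set r])).
  by apply: emeasurable_funM; [exact/measurable_EFinP|exact: mK].
under eq_integral => w _.
  rewrite integralT_nnsfun sintegralE ge0_mule_fsumr//.
  under eq_fsbigr do rewrite muleCA.
  over.
rewrite ge0_integral_fsum//.
- apply: eq_fsbigr => r _; have [r0|r0] := leP 0%R r.
    by rewrite ge0_integralZl// => w _; rewrite mule_ge0// lee_fin.
  under eq_integral do rewrite preimage_nnfun0// measure0 !mule0.
  rewrite integral0; under eq_integral do rewrite preimage_nnfun0// measure0 mule0.
  by rewrite integral0 mule0.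
- by move=> r; apply: emeasurable_funM => //; exact: measurable_cst.
- by move=> r w _; rewrite muleCA mule_ge0// lee_fin.
Qed.

Lemma mixture_limn (f : S -> \bar R) (mf : measurable_fun setT f) :
  (forall y, 0 <= f y) ->
  \int[P]_w ((G w)%:E * \int[K w]_y f y) =
  limn (fun n => \int[P]_w ((G w)%:E *
    \int[K w]_y (nnsfun_approx measurableT mf n y)%:E)).
Proof.
move=> f0; pose f_ n y := (nnsfun_approx measurableT mf n y)%:E.
have mf_ n : measurable_fun setT (f_ n) by exact/measurable_EFinP.
have f_0 n y : 0 <= f_ n y by rewrite lee_fin.
have ndf y : {homo f_^~ y : n m / (n <= m)%N >-> n <= m}.
  by move=> a b ab; rewrite lee_fin; exact/lefP/nd_nnsfun_approx.
have fE w : \int[K w]_y f y = limn (fun n => \int[K w]_y f_ n y).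
  rewrite -monotone_convergence//; apply: eq_integral => y _.
  by apply/esym/cvg_lim => //; exact: cvg_nnsfun_approx.
have ndK w : {homo (fun n => \int[K w]_y f_ n y) : n m / (n <= m)%N >-> n <= m}.
  by move=> a b ab; apply: ge0_le_integral => // y _; exact: ndf.
rewrite -monotone_convergence//.
- apply: eq_integral => w _; rewrite fE limeMl//.
  by apply: ereal_nondecreasing_is_cvgn; exact: ndK.
- move=> n; apply: emeasurable_funM; first exact/measurable_EFinP.
  exact: (measurable_fun_integral_kernel mK (f_0 n) (mf_ n)).
- move=> n w _; rewrite mule_ge0 ?lee_fin//; apply: integral_ge0 => y _.
  exact: f_0.
- by move=> w _ a b ab; rewrite lee_wpmul2l ?lee_fin//; exact: ndK.
Qed.

End one_family.

(** The monotone-class step that turns every hypothesis about events into a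
    statement about functions.  It serves with a Dirac family and two weights
    (conditional probabilities against past-measurable weights), with a Dirac
    family and a kernel (the Markov property against functions), and for
    invariant and marginal laws. *)
Lemma eq_mixture (K1 K2 : Om -> {measure set S -> \bar R}) (G1 G2 : Om -> R) :
  (forall U, measurable U -> measurable_fun [set: Om] (K1 ^~ U)) ->
  (forall U, measurable U -> measurable_fun [set: Om] (K2 ^~ U)) ->
  (forall w, (0 <= G1 w)%R) -> (forall w, (0 <= G2 w)%R) ->
  measurable_fun [set: Om] G1 -> measurable_fun [set: Om] G2 ->
  (forall U, measurable U ->
    \int[P]_w ((G1 w)%:E * K1 w U) = \int[P]_w ((G2 w)%:E * K2 w U)) ->
  forall f : S -> \bar R, measurable_fun setT f -> (forall y, 0 <= f y) ->
  \int[P]_w ((G1 w)%:E * \int[K1 w]_y f y) =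
  \int[P]_w ((G2 w)%:E * \int[K2 w]_y f y).
Proof.
move=> mK1 mK2 G10 G20 mG1 mG2 K12 f mf f0.
rewrite (mixture_limn mK1 G10 mG1 mf f0) (mixture_limn mK2 G20 mG2 mf f0).
congr (limn _); apply/funext => n; rewrite !mixture_nnsfun//.
by apply: eq_fsbigr => r _; rewrite K12//; exact: measurable_funPTI.
Qed.

End mixture.

(** * Bounded measurable functions *)

Definition bounded_mfun d (T : measurableType d) (R : realType) (f : T -> R) :=
  measurable_fun [set: T] f /\ exists M : R, forall x, `|f x| <= M.

Section bounded_mfun_theory.
Context d (T : measurableType d) (R : realType).
Implicit Types f g : T -> R.

Lemma bounded_mfun_cst (c : R) : bounded_mfun (fun _ : T => c).
Proof. by split; [exact: measurable_cst|exists `|c|]. Qed.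

Lemma bounded_mfun_itv f lo hi : measurable_fun setT f ->
  (forall x, lo <= f x <= hi) -> bounded_mfun f.
Proof.
move=> mf flh; split => //; exists (`|lo| + `|hi|) => x; have /andP[] := flh x.
have := ler_norm hi; have := ler_norm (- lo); rewrite normrN ler_norml.
have := normr_ge0 lo; have := normr_ge0 hi => *; apply/andP; split; lra.
Qed.

Lemma bounded_mfunD f g : bounded_mfun f -> bounded_mfun g ->
  bounded_mfun (fun x => f x + g x).
Proof.
move=> [mf [M fM]] [mg [N gN]]; split; first exact: measurable_funD.
by exists (M + N) => x; rewrite (le_trans (ler_normD _ _))// lerD.
Qed.

Lemma bounded_mfunM f g : bounded_mfun f -> bounded_mfun g ->
  bounded_mfun (fun x => f x * g x).
Proof.
move=> [mf [M fM]] [mg [N gN]]; split; first exact: measurable_funM.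
by exists (M * N) => x; rewrite normrM ler_pM.
Qed.

Lemma bounded_mfunZ c f : bounded_mfun f -> bounded_mfun (fun x => c * f x).
Proof. exact: bounded_mfunM (bounded_mfun_cst c). Qed.

Lemma bounded_mfunB f g : bounded_mfun f -> bounded_mfun g ->
  bounded_mfun (fun x => f x - g x).
Proof.
move=> bf /(bounded_mfunZ (-1)) bg; have := bounded_mfunD bf bg.
by under eq_fun do rewrite mulN1r.
Qed.

Lemma bounded_mfunX f n : bounded_mfun f -> bounded_mfun (fun x => f x ^+ n).
Proof.
move=> bf; elim: n => [|n ih]; first exact: bounded_mfun_cst.
by under eq_fun do rewrite exprS; exact: bounded_mfunM.
Qed.

Lemma bounded_mfun_expR f : bounded_mfun f -> bounded_mfun (fun x => expR (f x)).
Proof.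
move=> [mf [M fM]]; split; first exact: measurableT_comp.
exists (expR M) => x; rewrite ger0_norm ?expR_ge0// ler_expR.
exact: le_trans (ler_norm _) (fM x).
Qed.

Lemma bounded_mfun_comp d' (S : measurableType d') (h : S -> T) f :
  measurable_fun setT h -> bounded_mfun f -> bounded_mfun (f \o h).
Proof.
move=> mh [mf [M fM]]; split; first exact: measurableT_comp.
by exists M => x; exact: fM.
Qed.

End bounded_mfun_theory.

Section expectation_bounded.
Context d (T : measurableType d) (R : realType).
Variable mu : {measure set T -> \bar R}.
Hypothesis mu1 : mu [set: T] = 1%E.
Implicit Types f g h : T -> R.

Local Notation E f := (\int[mu]_x f x)%R.

Lemma bounded_mfun_integrable f : bounded_mfun f ->
  mu.-integrable setT (EFin \o f).
Proof.
move=> [mf [M fM]]; apply: measurable_bounded_integrable => //.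
  by rewrite mu1 ltry.
exists M; split; first exact: num_real.
by move=> y My x _; exact: le_trans (fM x) (ltW My).
Qed.

Let int := bounded_mfun_integrable.

Lemma EFin_Rintegral f : bounded_mfun f ->
  (E f)%:E = (\int[mu]_x (f x)%:E)%E.
Proof. by move=> /int bf; rewrite fineK// integrable_fin_num. Qed.

Lemma bRintegralD f g : bounded_mfun f -> bounded_mfun g ->
  E (fun x => f x + g x) = E f + E g.
Proof. by move=> /int ? /int ?; exact: RintegralD. Qed.

Lemma bRintegralB f g : bounded_mfun f -> bounded_mfun g ->
  E (fun x => f x - g x) = E f - E g.
Proof. by move=> /int ? /int ?; exact: RintegralB. Qed.

Lemma bRintegralZ c f : bounded_mfun f -> E (fun x => c * f x) = c * E f.
Proof. by move=> /int ?; exact: RintegralZl. Qed.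

Lemma bRintegral_cst (c : R) : E (fun _ => c) = c.
Proof. by rewrite Rintegral_cst// mu1 mulr1. Qed.

Lemma le_bRintegral f g : bounded_mfun f -> bounded_mfun g ->
  (forall x, f x <= g x) -> E f <= E g.
Proof. by move=> /int ? /int ? fg; exact: le_Rintegral. Qed.

(** Assuming only [h ^ 2 <= f g] pointwise makes it possible to use a majorant of
    a quotient as one of the two factors, without square roots or divisions of
    functions. *)
Lemma cauchy_schwarz_pointwise f g h :
  bounded_mfun f -> bounded_mfun g -> bounded_mfun h ->
  (forall x, 0 <= f x) -> (forall x, 0 <= g x) ->
  (forall x, h x ^+ 2 <= f x * g x) -> E h ^+ 2 <= E f * E g.
Proof.
move=> bf bg bh f0 g0 hfg.
have Ef0 : 0 <= E f by exact: Rintegral_ge0.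
have Eg0 : 0 <= E g by exact: Rintegral_ge0.
have quad c : 0 <= c ^+ 2 * E f - (2 * c) * E h + E g.
  have b1 := bounded_mfunZ (c ^+ 2) bf; have b2 := bounded_mfunZ (2 * c) bh.
  rewrite -!bRintegralZ// -bRintegralB// -bRintegralD//; last exact: bounded_mfunB.
  apply: Rintegral_ge0 => x _.
  have := hfg x; have := f0 x; have := g0 x.
  move: (f x) (g x) (h x) => {b1 b2} p q r q0; rewrite le_eqVlt => /predU1P[<-|p0].
    rewrite mul0r => r2; have : r ^+ 2 == 0 by rewrite eq_le r2 sqr_ge0.
    by rewrite sqrf_eq0 => /eqP->; lra.
  move=> rpq; rewrite -(pmulr_rge0 _ p0).
  have := sqr_ge0 (c * p - r); lra.
move: Ef0; rewrite le_eqVlt => /predU1P[Ef0|Ef0].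
  rewrite -Ef0 mul0r; move: quad; rewrite -Ef0 => quad.
  have [->|Eh0] := eqVneq (E h) 0; first by rewrite expr0n.
  (* the quadratic is affine here, and takes the value -1 at this point *)
  have := quad ((E g + 1) / (2 * E h)).
  rewrite mulr0 sub0r mulrA [2 * _]mulrC.
  rewrite [X in - X](_ : _ = E g + 1); first by lra.
  by field.
have := quad (E h / E f); rewrite -(pmulr_rge0 _ Ef0).
rewrite [leRHS](_ : _ = E f * E g - E h ^+ 2) ?subr_ge0//.
by field; rewrite gt_eqF.
Qed.

End expectation_bounded.

Lemma Rintegral_dirac d (T : measurableType d) (R : realType) (a : T) (f : T -> R) :
  measurable_fun setT f -> (\int[\d_a]_y f y)%R = f a.
Proof.
move=> mf; rewrite /Rintegral integral_dirac//; last exact/measurable_EFinP.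
by rewrite diracT mul1e.
Qed.

Section bounded_mixture.
Context d d' (Om : measurableType d) (S : measurableType d') (R : realType).
Variable P : {measure set Om -> \bar R}.
Hypothesis P1 : P [set: Om] = 1%E.

Lemma bounded_mfun_mixture (K : Om -> {measure set S -> \bar R}) (f : S -> R) :
  (forall U, measurable U -> measurable_fun [set: Om] (K ^~ U)) ->
  (forall w, K w [set: S] = 1%E) -> bounded_mfun f ->
  bounded_mfun (fun w => \int[K w]_y f y).
Proof.
move=> mK K1 bf; have [mf [M fM]] := bf; split; last first.
  exists M => w; rewrite ler_norml; apply/andP; split.
    rewrite -[leLHS](bRintegral_cst (K1 w)); apply: (le_bRintegral (K1 w)) => //.
      exact: bounded_mfun_cst.
    by move=> y; have := fM y; rewrite ler_norml => /andP[].
  rewrite -[leRHS](bRintegral_cst (K1 w)); apply: (le_bRintegral (K1 w)) => //.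
    exact: bounded_mfun_cst.
  by move=> y; have := fM y; rewrite ler_norml => /andP[].
have bM : bounded_mfun (fun _ : S => M) by exact: bounded_mfun_cst.
have bfM := bounded_mfunD bf bM.
have -> : (fun w => \int[K w]_y f y) =
    (fun w => fine (\int[K w]_y (f y + M)%:E)%E - M).
  apply/funext => w; rewrite -(EFin_Rintegral (K1 w) bfM)/=.
  by rewrite (bRintegralD (K1 w))// (bRintegral_cst (K1 w)) addrK.
apply: measurable_funB; last exact: measurable_cst.
apply: measurableT_comp; first exact: fine_measurable.
apply: measurable_fun_integral_kernel => //.
- by move=> y; rewrite lee_fin -lerBlDr sub0r; have := fM y; rewrite ler_norml => /andP[].
- by apply/measurable_EFinP; case: bfM.
Qed.

(** A bound [M] of [|f|] makes [f + M] nonnegative, and the claim is linear in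
    [f]. *)
Lemma eq_bounded_mixture (K1 K2 : Om -> {measure set S -> \bar R})
    (G1 G2 : Om -> R) :
  (forall U, measurable U -> measurable_fun [set: Om] (K1 ^~ U)) ->
  (forall U, measurable U -> measurable_fun [set: Om] (K2 ^~ U)) ->
  (forall w, K1 w [set: S] = 1%E) -> (forall w, K2 w [set: S] = 1%E) ->
  (forall w, 0 <= G1 w) -> (forall w, 0 <= G2 w) ->
  bounded_mfun G1 -> bounded_mfun G2 ->
  (forall U, measurable U ->
    \int[P]_w ((G1 w)%:E * K1 w U) = \int[P]_w ((G2 w)%:E * K2 w U))%E ->
  forall f : S -> R, bounded_mfun f ->
  \int[P]_w (G1 w * \int[K1 w]_y f y) = \int[P]_w (G2 w * \int[K2 w]_y f y).
Proof.
move=> mK1 mK2 K11 K21 G10 G20 bG1 bG2 K12.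
have pos f : bounded_mfun f -> (forall y, 0 <= f y) ->
    \int[P]_w (G1 w * \int[K1 w]_y f y) = \int[P]_w (G2 w * \int[K2 w]_y f y).
  move=> bf f0.
  have mf : measurable_fun setT (EFin \o f) by apply/measurable_EFinP; case: bf.
  have mG1 : measurable_fun setT G1 by case: bG1.
  have mG2 : measurable_fun setT G2 by case: bG2.
  have := eq_mixture mK1 mK2 G10 G20 mG1 mG2 K12 mf; rewrite /comp => h.
  rewrite /Rintegral; congr fine.
  under eq_integral do rewrite EFinM -/(Rintegral _ _ _) (EFin_Rintegral (K11 _) bf).
  under [in RHS]eq_integral do
    rewrite EFinM -/(Rintegral _ _ _) (EFin_Rintegral (K21 _) bf).
  by apply: h => y; rewrite lee_fin.
move=> f bf; have [mf [M fM]] := bf.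
have bM : bounded_mfun (fun _ : S => M) by exact: bounded_mfun_cst.
have M0 (y : S) : 0 <= M by rewrite (le_trans _ (fM y)).
have fM0 y : 0 <= f y + M.
  by rewrite -lerBlDr sub0r; have := fM y; rewrite ler_norml => /andP[].
have E1 := pos _ (bounded_mfunD bf bM) fM0; have E2 := pos _ bM M0.
have split_sum (K : Om -> {measure set S -> \bar R}) G :
    (forall U, measurable U -> measurable_fun [set: Om] (K ^~ U)) ->
    (forall w, K w [set: S] = 1%E) -> bounded_mfun G ->
    \int[P]_w (G w * \int[K w]_y f y) =
    \int[P]_w (G w * \int[K w]_y (f y + M)) - \int[P]_w (G w * \int[K w]_y M).
  move=> mK K1w bG.
  rewrite -bRintegralB//; first last.
  - exact: bounded_mfunM bG (bounded_mfun_mixture mK K1w bM).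
  - exact: bounded_mfunM bG (bounded_mfun_mixture mK K1w (bounded_mfunD bf bM)).
  apply: eq_Rintegral => w _.
  by rewrite (bRintegralD (K1w w))// mulrDr addrK.
by rewrite (split_sum K1 G1)// E1 E2 -split_sum.
Qed.

End bounded_mixture.

(** * The operator of a Markov kernel *)

Section markov_operator.
Context d (T : measurableType d) (R : realType) (k : R.-pker T ~> T).
Implicit Types f g h : T -> R.

Definition kernel_mean f x : R := \int[k x]_y f y.

Lemma bounded_kernel_mean f : bounded_mfun f -> bounded_mfun (kernel_mean f).
Proof.
by apply: bounded_mfun_mixture => [U mU|w];
  [exact: measurable_kernel|exact: prob_kernel].
Qed.

Lemma markov_opE f x : bounded_mfun f -> markov_op k f x = (kernel_mean f x)%:E.
Proof. by move=> bf; rewrite (EFin_Rintegral (prob_kernel _)). Qed.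

Lemma kernel_meanB f g x : bounded_mfun f -> bounded_mfun g ->
  kernel_mean (fun y => f y - g y) x = kernel_mean f x - kernel_mean g x.
Proof. by move=> bf bg; rewrite /kernel_mean (bRintegralB (prob_kernel _)). Qed.

Lemma kernel_meanZ c f x : bounded_mfun f ->
  kernel_mean (fun y => c * f y) x = c * kernel_mean f x.
Proof. by move=> bf; rewrite /kernel_mean (bRintegralZ (prob_kernel _)). Qed.

Lemma kernel_mean_cst c x : kernel_mean (fun=> c) x = c.
Proof. by rewrite /kernel_mean (bRintegral_cst (prob_kernel _)). Qed.

Variable mu : probability T R.
Hypothesis inv : invariant_law k mu.

Local Notation E f := (\int[mu]_x f x)%R.
Let mu1 : mu [set: T] = 1%E := probability_setT mu.

Lemma Rintegral_kernel_mean f : bounded_mfun f -> E (kernel_mean f) = E f.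
Proof.
move=> bf.
have b1 := bounded_mfun_cst T (1 : R).
transitivity (E (fun x => 1 * kernel_mean f x)).
  by apply: eq_Rintegral => x _; rewrite mul1r.
rewrite (@eq_bounded_mixture _ _ T T R mu mu1 k (fun x => \d_x)
  (fun=> 1) (fun=> 1))//.
- by apply: eq_Rintegral => x _; rewrite mul1r Rintegral_dirac//; case: bf.
- exact: measurable_kernel.
- by move=> U mU; exact: measurable_fun_dirac.
- exact: prob_kernel.
- by move=> w; rewrite /= diracT.
move=> U mU; under eq_integral do rewrite mul1e.
rewrite inv// -[in LHS](setIT U) -integral_indic//.
by apply: eq_integral => w _; rewrite mul1e /= diracE indicE.
Qed.

Lemma Lnorm2_bounded f : bounded_mfun f ->
  ('N[mu]_2%:E[EFin \o f] = (Num.sqrt (E (fun x => f x ^+ 2)))%:E)%E.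
Proof.
move=> bf; rewrite unlock.
under eq_integral => x _.
  rewrite /= powR_mulrn ?normr_ge0// real_normK ?num_real//; over.
rewrite -(EFin_Rintegral mu1 (bounded_mfunX 2 bf)) poweR_EFin powR12_sqrt//.
by apply: Rintegral_ge0 => x _; exact: sqr_ge0.
Qed.

Lemma mem_Lfun2_bounded f : bounded_mfun f -> f \in Lfun mu 2%:E.
Proof.
move=> bf; rewrite inE; apply/andP; split; rewrite inE/=.
  by case: bf.
by rewrite /finite_norm Lnorm2_bounded ?ltry.
Qed.

(** The norm is a supremum over the unit ball, so [f] has to be rescaled; scaling
    by [1 / sqrt (F + eps)] rather than [1 / sqrt F] covers [F = 0] too. *)
Lemma opnorm_L2_0_contraction lam f : opnorm_L2_0 mu k = lam%:E ->
  bounded_mfun f -> E f = 0 ->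
  E (fun x => kernel_mean f x ^+ 2) <= lam ^+ 2 * E (fun x => f x ^+ 2).
Proof.
move=> norm_lam bf Ef0.
set A := E (fun x => kernel_mean f x ^+ 2); set F := E (fun x => f x ^+ 2).
have F0 : 0 <= F by apply: Rintegral_ge0 => x _; exact: sqr_ge0.
have A0 : 0 <= A by apply: Rintegral_ge0 => x _; exact: sqr_ge0.
have scaled c : 0 <= c -> c ^+ 2 * F <= 1 -> c ^+ 2 * A <= lam ^+ 2.
  move=> c0 cF.
  have bcf := bounded_mfunZ c bf.
  have sqE g : bounded_mfun g ->
      E (fun x => (c * g x) ^+ 2) = c ^+ 2 * E (fun x => g x ^+ 2).
    move=> bg; rewrite -(bRintegralZ mu1); last exact: bounded_mfunX.
    by apply: eq_Rintegral => x _; rewrite exprMn.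
  have : ('N[mu]_2%:E[markov_op k (fun x => c * f x)%R] <= lam%:E)%E.
    rewrite -norm_lam; apply: ereal_sup_ubound => /=.
    exists (fun x => c * f x) => //; split; last first.
      by rewrite Lnorm2_bounded// sqE// lee_fin -[leRHS]sqrtr1 ler_sqrt.
    split; first exact: mem_Lfun2_bounded.
    rewrite unlock -(EFin_Rintegral mu1 bcf) (bRintegralZ mu1)// Ef0.
    by rewrite mulr0.
  have bK := bounded_kernel_mean bf.
  rewrite (_ : markov_op _ _ = EFin \o (fun x => c * kernel_mean f x)); last first.
    by apply/funext => x; rewrite markov_opE// kernel_meanZ.
  rewrite Lnorm2_bounded ?sqE//; last exact: bounded_mfunZ.
  rewrite lee_fin => h.
  have lam0 : 0 <= lam by rewrite (le_trans _ h)// sqrtr_ge0.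
  by rewrite -(@sqr_sqrtr _ (c ^+ 2 * A)) ?mulr_ge0 ?sqr_ge0// ler_sqr// nnegrE sqrtr_ge0.
apply/ler_addgt0Pr => e e0.
pose eps := e / (lam ^+ 2 + 1).
have l1 : 0 < lam ^+ 2 + 1 by rewrite ltr_wpDl// sqr_ge0.
have eps0 : 0 < eps by rewrite divr_gt0.
have Fe0 : 0 < F + eps by rewrite ltr_wpDl.
have := scaled (Num.sqrt (F + eps)^-1) (sqrtr_ge0 _).
rewrite sqr_sqrtr ?invr_ge0 ?(ltW Fe0)// ler_pdivrMl// mulr1 lerDl => /(_ (ltW eps0)).
rewrite ler_pdivrMl// => /le_trans; apply.
rewrite mulrC mulrDr lerD2l /eps mulrCA ger_pMr// ler_pdivrMr// mul1r lerDl//.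
Qed.

End markov_operator.

(** * Comparison with the Leon-Perron operator *)

Section leon_perron.
Context d (T : measurableType d) (R : realType) (mu : probability T R).
Implicit Types (f g h v : T -> R) (l : R).
Local Notation E f := (\int[mu]_x f x)%R.
Let mu1 : mu [set: T] = 1%E := probability_setT mu.

(** The quadratic form [<v, (l I + (1 - l) E) v>] of the operator that mixes the
    identity with the projection on constants; it is the extremal kernel with
    spectral gap [1 - l]. *)
Definition leon_perron_form l v : R :=
  (1 - l) * E v ^+ 2 + l * E (fun x => v x ^+ 2).

Lemma variance_shift v : bounded_mfun v ->
  E (fun x => (v x - E v) ^+ 2) = E (fun x => v x ^+ 2) - E v ^+ 2.
Proof.
move=> bv; set m := E v.
have b2 := bounded_mfunX 2 bv; have bm := bounded_mfunZ (2 * m) bv.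
have bc := bounded_mfun_cst T (m ^+ 2).
transitivity (E (fun x => v x ^+ 2 - 2 * m * v x + m ^+ 2)).
  by apply: eq_Rintegral => x _; ring.
rewrite (bRintegralD mu1)//; last exact: bounded_mfunB.
rewrite (bRintegralB mu1)// (bRintegralZ mu1)// (bRintegral_cst mu1) -/m; ring.
Qed.

(** Centring both functions splits the left-hand side into [E f * E g] and a term
    between mean-zero functions, where the contraction applies; a second
    Cauchy-Schwarz, in the plane, recombines them. *)
Lemma kernel_form_le (k : R.-pker T ~> T) l f g : invariant_law k mu ->
  0 <= l ->
  (forall h, bounded_mfun h -> E h = 0 ->
    E (fun x => kernel_mean k h x ^+ 2) <= l ^+ 2 * E (fun x => h x ^+ 2)) ->
  bounded_mfun f -> bounded_mfun g ->
  E (fun x => f x * kernel_mean k g x) ^+ 2 <=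
  leon_perron_form l f * leon_perron_form l g.
Proof.
move=> inv l0 contr bf bg; set a := E f; set b := E g.
pose f0 x := f x - a; pose g0 x := g x - b.
have bca := bounded_mfun_cst T a; have bcb := bounded_mfun_cst T b.
have bf0 : bounded_mfun f0 by exact: bounded_mfunB.
have bg0 : bounded_mfun g0 by exact: bounded_mfunB.
have bK0 := bounded_kernel_mean k bg0.
have Eg0 : E g0 = 0 by rewrite (bRintegralB mu1)// (bRintegral_cst mu1) subrr.
have EK0 : E (kernel_mean k g0) = 0 by rewrite (Rintegral_kernel_mean inv).
pose c := E (fun x => f0 x * kernel_mean k g0 x).
have bfK := bounded_mfunM bf0 bK0.
have -> : E (fun x => f x * kernel_mean k g x) = c + a * b.
  transitivity (E (fun x => (f0 x * kernel_mean k g0 x + a * kernel_mean k g0 x)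
                            + b * f x)).
    apply: eq_Rintegral => x _.
    rewrite (_ : kernel_mean k g x = kernel_mean k g0 x + b) /f0; first by ring.
    by rewrite kernel_meanB// kernel_mean_cst subrK.
  have baK := bounded_mfunZ a bK0; have bbf := bounded_mfunZ b bf.
  rewrite (bRintegralD mu1)//; last exact: bounded_mfunD.
  rewrite (bRintegralD mu1)// !(bRintegralZ mu1)// EK0 mulr0 addr0 -/c -/a.
  by rewrite [b * a]mulrC.
pose F := E (fun x => f0 x ^+ 2); pose G := E (fun x => g0 x ^+ 2).
have F0 : 0 <= F by apply: Rintegral_ge0 => x _; exact: sqr_ge0.
have G0 : 0 <= G by apply: Rintegral_ge0 => x _; exact: sqr_ge0.
have cFG : c ^+ 2 <= l ^+ 2 * F * G.
  have -> : l ^+ 2 * F * G = F * (l ^+ 2 * G) by ring.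
  apply: le_trans (ler_wpM2l F0 (contr _ bg0 Eg0)).
  apply: (cauchy_schwarz_pointwise mu1) => //; try exact: bounded_mfunX.
  - by move=> x; exact: sqr_ge0.
  - by move=> x; exact: sqr_ge0.
  - by move=> x; rewrite exprMn.
have formE v : bounded_mfun v ->
    leon_perron_form l v = E v ^+ 2 + l * E (fun x => (v x - E v) ^+ 2).
  by move=> bv; rewrite variance_shift// /leon_perron_form; ring.
rewrite !formE// -/a -/b -/F -/G.
have cross : 2 * c * (a * b) <= l * (a ^+ 2 * G + b ^+ 2 * F).
  have R0 : 0 <= l * (a ^+ 2 * G + b ^+ 2 * F).
    by rewrite mulr_ge0// addr_ge0// mulr_ge0// sqr_ge0.
  apply: le_trans (ler_norm _) _; rewrite -[leRHS]ger0_norm//.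
  rewrite -ler_sqr ?nnegrE ?normr_ge0// !real_normK ?num_real//.
  have ab0 : 0 <= 4 * (a * b) ^+ 2 by rewrite mulr_ge0// sqr_ge0.
  have := ler_wpM2l ab0 cFG.
  have := sqr_ge0 (l * (a ^+ 2 * G - b ^+ 2 * F)); lra.
lra.
Qed.

(** Cauchy-Schwarz with the weight [psi = r - l exp g] bounds [(E (w v)) ^ 2] by
    [E (exp g / psi) * E (psi v ^ 2)].  The affine majorant [A] of
    [(1 - l) exp g / psi] replaces the first factor, and has mean 1 since [g] is
    centred. *)
Lemma leon_perron_tilt l a b g v : 0 <= l -> l < 1 -> a < b ->
  bounded_mfun g -> (forall x, a <= g x <= b) -> E g = 0 -> bounded_mfun v ->
  leon_perron_form l (fun x => expR (g x / 2) * v x) <=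
  expR ((1 + l) / (1 - l) * (b - a) ^+ 2 / 8) * E (fun x => v x ^+ 2).
Proof.
move=> l0 l1 ab bg gab Eg bv.
have a0 : a <= 0.
  rewrite -Eg -[leLHS](bRintegral_cst mu1); apply: (le_bRintegral mu1) => //.
    exact: bounded_mfun_cst.
  by move=> x; case/andP: (gab x).
have [s hs] := resolvent_affine_majorant l0 l1 a0 ab.
set r := expR _ in hs *; rewrite /leon_perron_form.
have bw : bounded_mfun (fun x => expR (g x / 2)).
  by under eq_fun do rewrite mulrC; exact: bounded_mfun_expR (bounded_mfunZ _ bg).
have be := bounded_mfun_expR bg.
have bv2 := bounded_mfunX 2 bv.
have wE x : expR (g x / 2) ^+ 2 = expR (g x).
  by rewrite expr2 -expRD -splitr.
pose psi x := r - l * expR (g x).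
have psi0 x : 0 < psi x by rewrite subr_gt0; case: (hs _ (gab x)).
have bpsi : bounded_mfun psi.
  by apply: bounded_mfunB; [exact: bounded_mfun_cst|exact: bounded_mfunZ].
pose A x := 1 + s * g x.
have bA : bounded_mfun A.
  by apply: bounded_mfunD; [exact: bounded_mfun_cst|exact: bounded_mfunZ].
have l1' : 0 < 1 - l by rewrite subr_gt0.
have hA x : (1 - l) * (expR (g x) / psi x) <= A x by case: (hs _ (gab x)).
have A0 x : 0 <= A x.
  apply: le_trans (hA x); rewrite mulr_ge0 ?(ltW l1')// divr_ge0 ?expR_ge0//.
  exact: ltW.
have EA : E A = 1.
  rewrite (bRintegralD mu1); [|exact: bounded_mfun_cst|exact: bounded_mfunZ].
  by rewrite (bRintegral_cst mu1) (bRintegralZ mu1)// Eg mulr0 addr0.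
have bpv : bounded_mfun (fun x => (1 - l)^-1 * (psi x * v x ^+ 2)).
  by apply: bounded_mfunZ; exact: bounded_mfunM.
have CS : E (fun x => expR (g x / 2) * v x) ^+ 2 <=
    E A * E (fun x => (1 - l)^-1 * (psi x * v x ^+ 2)).
  apply: (cauchy_schwarz_pointwise mu1) => //; first exact: bounded_mfunM.
    move=> x; rewrite mulr_ge0 ?invr_ge0 ?(ltW l1')// mulr_ge0 ?sqr_ge0//.
    exact: ltW.
  move=> x; rewrite exprMn wE.
  have v20 := sqr_ge0 (v x).
  rewrite [leRHS]mulrCA ler_pdivlMl// [leLHS]mulrA [leRHS]mulrA ler_wpM2r//.
  by have := hA x; rewrite mulrA ler_pdivrMr.
rewrite EA mul1r (bRintegralZ mu1) ?ler_pdivlMl// in CS; last exact: bounded_mfunM.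
rewrite -lerBrDr (le_trans CS)//.
have bev : bounded_mfun (fun x => expR (g x) * v x ^+ 2) by exact: bounded_mfunM.
rewrite (_ : E (fun x => (expR (g x / 2) * v x) ^+ 2) =
             E (fun x => expR (g x) * v x ^+ 2)); last first.
  by apply: eq_Rintegral => x _; rewrite exprMn wE.
have b1 := bounded_mfunZ r bv2; have b2 := bounded_mfunZ l bev.
rewrite -!(bRintegralZ mu1)// -(bRintegralB mu1)//.
by rewrite le_eqVlt; apply/orP; left; apply/eqP; apply: eq_Rintegral => x _;
  rewrite /psi; ring.
Qed.

(** Test the form inequality with [v = w K (w g)] itself: its left-hand side is
    then [E (v ^ 2) ^ 2], and one factor cancels. *)
Lemma tilted_kernel_contraction (k : R.-pker T ~> T) l r w g :
  invariant_law k mu -> 0 <= l -> 0 <= r ->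
  (forall h, bounded_mfun h -> E h = 0 ->
    E (fun x => kernel_mean k h x ^+ 2) <= l ^+ 2 * E (fun x => h x ^+ 2)) ->
  bounded_mfun w ->
  (forall v, bounded_mfun v -> 
    leon_perron_form l (fun x => w x * v x) <= r * E (fun x => v x ^+ 2)) ->
  bounded_mfun g ->
  E (fun x => (w x * kernel_mean k (fun y => w y * g y) x) ^+ 2) <=
  r ^+ 2 * E (fun x => g x ^+ 2).
Proof.
move=> inv l0 r0 contr bw tilt bg.
have bwg := bounded_mfunM bw bg.
pose v x := w x * kernel_mean k (fun y => w y * g y) x.
have bv : bounded_mfun v by apply: bounded_mfunM => //; exact: bounded_kernel_mean.
set X := (X in X <= _).
have X0 : 0 <= X by apply: Rintegral_ge0 => x _; exact: sqr_ge0.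
have Y0 : 0 <= E (fun x => g x ^+ 2).
  by apply: Rintegral_ge0 => x _; exact: sqr_ge0.
have form0 f : bounded_mfun f -> 0 <= leon_perron_form l f.
  move=> bf; rewrite (_ : leon_perron_form l f =
      E f ^+ 2 + l * E (fun x => (f x - E f) ^+ 2)).
    rewrite addr_ge0 ?sqr_ge0// mulr_ge0//.
    by apply: Rintegral_ge0 => x _; exact: sqr_ge0.
  by rewrite variance_shift// /leon_perron_form; ring.
have := kernel_form_le inv l0 contr (bounded_mfunM bw bv) bwg.
rewrite (_ : E (fun x => w x * v x * _) = X); last first.
  by apply: eq_Rintegral => x _; rewrite /v; ring.
move=> /le_trans /(_ (ler_pM (form0 _ (bounded_mfunM bw bv)) (form0 _ bwg)
  (tilt _ bv) (tilt _ bg))).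
rewrite -/X.
move: X0; rewrite le_eqVlt => /predU1P[<- _|X0].
  by rewrite mulr_ge0// sqr_ge0.
by rewrite expr2 [leRHS](_ : _ = X * (r ^+ 2 * E (fun x => g x ^+ 2)));
  [rewrite ler_pM2l|ring].
Qed.

End leon_perron.

(** * Exponential functionals of the chain *)

Section chain.
Context d d' (Om : measurableType d) (T : measurableType d') (R : realType).
Variables (P : probability Om R) (N : nat) (mu : probability T R).
Variables (k : 'I_N -> R.-pker T ~> T) (X : 'I_N -> {mfun Om >-> T}).
Hypothesis chainX : markov_chain P mu k X.
Hypothesis inv : forall i, invariant_law (k i) mu.
Implicit Types (f g w : T -> R).

Local Notation EP f := (\int[P]_x f x)%R.
Local Notation E f := (\int[mu]_x f x)%R.
Let P1 : P [set: Om] = 1%E := probability_setT P.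
Let mu1 : mu [set: T] = 1%E := probability_setT mu.

Definition past_generators (i : 'I_N) : set (set Om) :=
  \big[setU/set0]_(j < i.+1) preimage_set_system setT
    (X (widen_ord (ltn_ord i) j) : Om -> T) measurable.
(** The sample space with the sigma-algebra generated by the states up to time
    [i], so that past-measurable functions are the measurable functions on a
    type. *)
Definition past (i : 'I_N) := g_sigma_algebraType (past_generators i).

Lemma past_measurable (i : 'I_N) (A : set Om) :
  @measurable _ (past i) A -> measurable A.
Proof.
move=> pA; apply: (smallest_sub _ _ pA); first exact: sigma_algebra_measurable.
rewrite /past_generators; elim/big_ind : _ => //.
  by move=> B C hB hC U [/hB|/hC].
move=> j _ U [V mV <-]; rewrite setTI.
exact: measurable_funPTI.
Qed.

Lemma past_measurable_fun (i m : 'I_N) : (m <= i)%N ->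
  measurable_fun [set: past i] (X m : past i -> T).
Proof.
move=> mi _ B mB; rewrite setTI; apply: sub_sigma_algebra.
pose m' := Ordinal (mi : (m < i.+1)%N).
rewrite /past_generators (bigD1 m')//=; left.
exists B => //; rewrite setTI; congr (X _ @^-1` B).
exact: val_inj.
Qed.

Lemma measurable_X m : measurable_fun setT (X m). Proof. exact: measurable_funPT. Qed.

(** The Markov property between two functions.  Conditional probabilities are
    given on past events [U] and target events [B]; fixing [B] and extending in
    [U] gives [indicator], which is then extended in [B]. *)
Lemma markov_step_expectation (i j : 'I_N) (Z : past i -> R) f :
  j = i.+1 :> nat ->
  bounded_mfun Z -> (forall o, 0 <= Z o) -> bounded_mfun f ->
  EP (fun o => Z o * f (X j o)) = EP (fun o => Z o * kernel_mean (k i) f (X i o)).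
Proof.
move=> ji bZ Z0 bf; have [mZ [M ZM]] := bZ.
have bZ' : bounded_mfun (Z : Om -> R).
  split; last by exists M.
  move=> _ B mB; rewrite setTI; apply: (@past_measurable i).
  by rewrite -[X in measurable X]setTI; exact: mZ.
have mdX (Y : {mfun Om >-> T}) U : measurable U ->
    measurable_fun [set: Om] (fun o => \d_(Y o) U : \bar R).
  move=> mU; apply: (@measurableT_comp _ _ _ _ _ _ (fun y => \d_y U)) => //.
  exact: measurable_fun_dirac.
have mkX U : measurable U -> measurable_fun [set: Om] (fun o => k i (X i o) U).
  move=> mU; apply: (@measurableT_comp _ _ _ _ _ _ (fun y => k i y U)) => //.
  exact: measurable_kernel.
have indicator B : measurable B ->
    (\int[P]_o ((Z o)%:E * \d_(X j o) B) = \int[P]_o ((Z o)%:E * k i (X i o) B))%E.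
  move=> mB; pose p o := fine (k i (X i o) B).
  have pE o : (p o)%:E = k i (X i o) B.
    by rewrite fineK//; exact: (finite_kernel_measure (k i) (X i o)).
  have bp : bounded_mfun p.
    split; first by apply: measurableT_comp; [exact: fine_measurable|exact: mkX].
    exists 1 => o; rewrite ger0_norm ?fine_ge0//.
    by rewrite -lee_fin pE -(prob_kernel (s := k i) (X i o)) le_measure// inE.
  have bI : bounded_mfun (fun o => \1_B (X j o) : R).
    split; first exact: measurableT_comp.
    by exists 1 => o; rewrite indicE ger0_norm// lern1 leq_b1.
  transitivity (EP (fun o => \1_B (X j o) * Z o))%:E.
    rewrite (EFin_Rintegral P1 (bounded_mfunM bI bZ')).
    by apply: eq_integral => o _; rewrite /= diracE -indicE EFinM muleC.
  transitivity (EP (fun o => p o * Z o))%:E; last first.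
    rewrite (EFin_Rintegral P1 (bounded_mfunM bp bZ')).
    by apply: eq_integral => o _; rewrite EFinM muleC pE.
  congr EFin.
  have dZ (o : past i) : \int[\d_o]_y Z y = Z o by exact: Rintegral_dirac.
  transitivity (EP (fun o => \1_B (X j o) * \int[\d_(o : past i)]_y Z y)).
    by apply: eq_Rintegral => o _; rewrite dZ.
  transitivity (EP (fun o => p o * \int[\d_(o : past i)]_y Z y)); last first.
    by apply: eq_Rintegral => o _; rewrite dZ.
  have mdo U : @measurable _ (past i) U ->
      measurable_fun [set: Om] (fun o => \d_(o : past i) U : \bar R).
    move=> /past_measurable mU.
    rewrite (_ : (fun _ => _) = EFin \o (\1_U : Om -> R)).
      by apply/measurable_EFinP; exact: measurable_indic.
    by apply/funext => o; rewrite /= diracE indicE.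
  apply: (@eq_bounded_mixture _ _ Om (past i) R P P1
    (fun o => \d_(o : past i)) (fun o => \d_(o : past i))
    (fun o => \1_B (X j o)) p) => //.
  - by move=> o; rewrite /= diracT.
  - by move=> o; rewrite /= diracT.
  - by move=> o; rewrite fine_ge0.
  move=> U pU; have mU := past_measurable pU.
  have [_ /(_ i j ji U B pU mB) step] := chainX.
  rewrite [RHS](_ : _ = \int[P]_(o in U) k i (X i o) B)%E; last first.
    rewrite [RHS]integral_mkcond; apply: eq_integral => o _.
    by rewrite /= diracE pE patchE; case: (o \in U); rewrite ?mule1 ?mule0.
  have mXB : measurable (X j @^-1` B) by exact: measurable_funPTI.
  rewrite -step -[in RHS](setIT (_ `&` _)) -integral_indic//; last first.
    exact: measurableI.
  apply: eq_integral => o _.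
  by rewrite /= diracE -indicE -EFinM indicI/= mulrC.
transitivity (EP (fun o => Z o * \int[\d_(X j o)]_y f y)).
  by apply: eq_Rintegral => o _; rewrite Rintegral_dirac//; case: bf.
apply: (@eq_bounded_mixture _ _ Om T R P P1 (fun o => \d_(X j o))
  (fun o => k i (X i o)) Z Z) => //.
- exact: mdX.
- by move=> o; rewrite /= diracT.
- by move=> o; exact: prob_kernel.
Qed.

Lemma marginal_law (i : 'I_N) B : measurable B -> P (X i @^-1` B) = mu B.
Proof.
have [chain0 step] := chainX.
case: i => n; elim: n B => [|n ih] B ni mB; first exact: (chain0 (Ordinal ni)).
pose i := Ordinal (ltnW ni).
have pT : past_sigma X i setT.
  by have := @measurableT _ (past i).
have := step i (Ordinal ni) erefl _ _ pT mB; rewrite setTI => ->.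
rewrite -(inv i mB).
transitivity (\int[distribution P (X i)]_y (k i y B))%E.
  rewrite ge0_integral_distribution//; exact: measurable_kernel.
by apply: eq_measure_integral => A mA _; exact: (ih A (ltnW ni)).
Qed.

Lemma marginal_expectation (i : 'I_N) f : bounded_mfun f ->
  EP (fun o => f (X i o)) = E f.
Proof.
move=> bf; have [mf _] := bf.
transitivity (EP (fun o => 1 * \int[\d_(X i o)]_y f y)).
  by apply: eq_Rintegral => o _; rewrite mul1r Rintegral_dirac.
rewrite (@eq_bounded_mixture _ _ Om T R P P1 (fun o => \d_(X i o))
  (fun o => mu) (fun=> 1) (fun=> 1))//.
- by rewrite (_ : (fun _ => _) = fun=> E f) ?(bRintegral_cst P1)//;
    apply/funext => o; rewrite mul1r.
- move=> U mU; apply: (@measurableT_comp _ _ _ _ _ _ (fun y => \d_y U)) => //.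
  exact: measurable_fun_dirac.
- by move=> o; rewrite /= diracT.
- exact: bounded_mfun_cst.
- exact: bounded_mfun_cst.
move=> U mU; under [RHS]eq_integral do rewrite mul1e.
rewrite integral_cst//= P1 mule1 -(marginal_law i mU).
rewrite -[in RHS](setIT (_ @^-1` _)) -integral_indic//.
  by apply: eq_integral => o _; rewrite /= mul1e diracE.
exact: measurable_funPTI.
Qed.

Lemma past_prod_bounded (i : 'I_N) (p : pred 'I_N) f :
  (forall m, p m -> (m <= i)%N) -> bounded_mfun f ->
  bounded_mfun (fun o : past i => \prod_(m < N | p m) f (X m o)).
Proof.
move=> pi bf.
under eq_fun do rewrite -big_filter.
have : all p [seq m <- index_enum 'I_N | p m] by exact: filter_all.
elim: [seq _ <- _ | _] => [_|m s ih /= /andP[pm /ih bs]].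
  by under eq_fun do rewrite big_nil; exact: bounded_mfun_cst.
under eq_fun do rewrite big_cons; apply: bounded_mfunM => //.
by apply: (bounded_mfun_comp (past_measurable_fun (pi _ pm)) bf).
Qed.

(** One step of the chain replaces [g] by [w K (w g)] and drops the last factor of
    the product, so the statement has to be proved for all [g] at once. *)
Lemma tilted_chain_bound r w : 0 <= r -> bounded_mfun w ->
  (forall i g, bounded_mfun g ->
    E (fun x => (w x * kernel_mean (k i) (fun y => w y * g y) x) ^+ 2) <=
    r ^+ 2 * E (fun x => g x ^+ 2)) ->
  forall (i : 'I_N) g, bounded_mfun g ->
  EP (fun o => \prod_(m < N | (m < i)%N) w (X m o) ^+ 2 *
               (w (X i o) * g (X i o))) ^+ 2 <=
  r ^+ (2 * i) * (E (fun x => w x ^+ 2) * E (fun x => g x ^+ 2)).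
Proof.
move=> r0 bw contr [n]; elim: n => [|n ih] ni g bg /=.
  under eq_Rintegral do rewrite big_pred0 ?mul1r//.
  have bwg := bounded_mfunM bw bg.
  rewrite (marginal_expectation (Ordinal ni) bwg) muln0 expr0 mul1r.
  apply: (cauchy_schwarz_pointwise mu1) => //; try exact: bounded_mfunX.
  - by move=> x; exact: sqr_ge0.
  - by move=> x; exact: sqr_ge0.
  - by move=> x; rewrite exprMn.
pose i := Ordinal (ltnW ni); pose j := Ordinal ni.
have bwg := bounded_mfunM bw bg.
have bK := bounded_kernel_mean (k i) bwg.
pose Z o := \prod_(m < N | (m < n.+1)%N) w (X m o) ^+ 2.
have bZ : bounded_mfun (Z : past i -> R).
  exact: (@past_prod_bounded i (fun m => m < n.+1)%N _ (fun _ h => h) (bounded_mfunX 2 bw)).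
have Z0 o : 0 <= Z o by apply: prodr_ge0 => m _; exact: sqr_ge0.
rewrite (@markov_step_expectation i j Z _ erefl bZ Z0 bwg).
(* the factor [w ^ 2] at time [n] is shared: one [w] goes to [h], the other is the
   [w] of the induction hypothesis *)
pose h x := w x * kernel_mean (k i) (fun y => w y * g y) x.
have bh : bounded_mfun h by exact: bounded_mfunM.
rewrite [X in X ^+ 2 <= _](_ : _ = EP (fun o => \prod_(m < N | (m < n)%N) w (X m o) ^+ 2 *
               (w (X i o) * h (X i o)))); last first.
  apply: eq_Rintegral => o _; rewrite /Z (bigD1 i)//=.
  rewrite (eq_bigl (fun m : 'I_N => (m < n)%N)); first by rewrite /h; ring.
  by move=> m; rewrite ltnS -(inj_eq val_inj)/= andbC -ltn_neqAle.
apply: le_trans (ih (ltnW ni) h bh) _.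
have w0 : 0 <= E (fun x => w x ^+ 2).
  by apply: Rintegral_ge0 => x _; exact: sqr_ge0.
have := ler_wpM2l w0 (contr i g bg); have := exprn_ge0 (2 * n) r0.
rewrite (_ : (2 * n.+1 = 2 * n + 2)%N) ?exprD; last by rewrite mulnS addnC.
rewrite -mulrA => rn0 /(ler_wpM2l rn0) /le_trans; apply.
by rewrite le_eqVlt; apply/orP; left; apply/eqP; ring.
Qed.

End chain.

(** * The concentration inequality *)

Section hoeffding.
Context d d' (Om : measurableType d) (T : measurableType d') (R : realType).
Variables (P : probability Om R) (N : nat) (mu : probability T R).
Variables (k : 'I_N -> R.-pker T ~> T) (X : 'I_N -> {mfun Om >-> T}) (l : R).
Hypothesis N_gt0 : (0 < N)%N.
Hypothesis chainX : markov_chain P mu k X.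
Hypothesis inv : forall i, invariant_law (k i) mu.
Hypotheses (l0 : 0 <= l) (l1 : l < 1).
Local Notation EP f := (\int[P]_x f x)%R.
Local Notation E f := (\int[mu]_x f x)%R.
Hypothesis contr : forall i h, bounded_mfun h -> E h = 0 ->
    E (fun x => kernel_mean (k i) h x ^+ 2) <= l ^+ 2 * E (fun x => h x ^+ 2).
Implicit Types f g : T -> R.
Let P1 : P [set: Om] = 1%E := probability_setT P.
Let mu1 : mu [set: T] = 1%E := probability_setT mu.

Lemma bounded_chain_sum g : bounded_mfun g ->
  bounded_mfun (fun o => \sum_(m < N) g (X m o)).
Proof.
move=> bg; elim: (index_enum _) => [|m s ih].
  by under eq_fun do rewrite big_nil; exact: bounded_mfun_cst.
under eq_fun do rewrite big_cons; apply: bounded_mfunD => //.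
exact: bounded_mfun_comp (measurable_X _ _) bg.
Qed.

(** The last factor is [w ^ 2], i.e. [g = w] in [tilted_chain_bound]; the two
    remaining norms are [E (w ^ 2) <= r], which is [leon_perron_tilt] at [v = w]
    together with [E (w ^ 2) ^ 2 <= E (w ^ 4)]. *)
Lemma chain_mgf_le a b g : a < b -> bounded_mfun g ->
  (forall x, a <= g x <= b) -> E g = 0 ->
  EP (fun o => expR (\sum_(m < N) g (X m o))) <=
  expR ((1 + l) / (1 - l) * (b - a) ^+ 2 / 8) ^+ N.
Proof.
move=> ab bg gab Eg; set r := expR _.
have r0 : 0 <= r by exact: expR_ge0.
pose w x := expR (g x / 2).
have bw : bounded_mfun w.
  by rewrite /w; under eq_fun do rewrite mulrC; exact: bounded_mfun_expR (bounded_mfunZ _ bg).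
have w2 x : w x ^+ 2 = expR (g x) by rewrite /w expr2 -expRD -splitr.
have tilt v := @leon_perron_tilt _ _ _ mu l a b g v l0 l1 ab bg gab Eg.
rewrite -/r -/w in tilt.
set A := E (fun x => w x ^+ 2).
have bw2 := bounded_mfunX 2 bw.
have A0 : 0 <= A by apply: Rintegral_ge0 => x _; exact: sqr_ge0.
have Ar : A <= r.
  have := tilt _ bw; rewrite /leon_perron_form.
  rewrite (_ : E (fun x => w x * w x) = A); last first.
    by apply: eq_Rintegral => x _; rewrite expr2.
  have : 0 <= E (fun x => (w x ^+ 2 - A) ^+ 2).
    by apply: Rintegral_ge0 => x _; exact: sqr_ge0.
  rewrite variance_shift// -/A.
  rewrite (_ : E (fun x => (w x * w x) ^+ 2) = E (fun x => (w x ^+ 2) ^+ 2)); last first.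
    by apply: eq_Rintegral => x _; rewrite !expr2.
  set B := E (fun x => (w x ^+ 2) ^+ 2); rewrite subr_ge0 => AB.
  have := ler_wpM2l l0 AB => lAB h.
  move: A0; rewrite le_eqVlt => /predU1P[<-//|A0].
  by rewrite -(ler_pM2r A0); apply: le_trans h; rewrite -expr2; lra.
case: N N_gt0 k X chainX inv contr => // n _ k' X' chainX' inv' contr'.
have step i g' (bg' : bounded_mfun g') :=
  tilted_kernel_contraction (inv' i) l0 r0 (contr' i) bw tilt bg'.
have := tilted_chain_bound chainX' inv' r0 bw step ord_max bw.
rewrite -/A -expr2 => bound.
rewrite -ler_sqr ?nnegrE ?exprn_ge0//; last first.
  by apply: Rintegral_ge0 => x _; exact: expR_ge0.
have -> : EP (fun o => expR (\sum_(m < n.+1) g (X' m o))) =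
    EP (fun o => \prod_(m < n.+1 | (m < (@ord_max n))%N) w (X' m o) ^+ 2 *
                (w (X' ord_max o) * w (X' ord_max o))).
  apply: eq_Rintegral => o _; rewrite expR_sum.
  rewrite (bigD1 ord_max)//= mulrC -expr2 w2; congr (_ * _).
  rewrite (eq_bigl (fun m : 'I_n.+1 => (m < n)%N)).
    by apply: eq_bigr => m _; rewrite w2.
  by move=> m; rewrite -(inj_eq val_inj)/= ltn_neqAle -[(m <= n)%N]ltnS ltn_ord andbT.
apply: le_trans bound _.
rewrite /= mulnC exprM -exprMn ler_sqr ?nnegrE ?mulr_ge0 ?exprn_ge0//.
by rewrite exprS mulrC ler_wpM2r// exprn_ge0.
Qed.

(** Markov's inequality for [exp (t N (E f - empirical mean))].  The case
    [lo = hi] is separate because the two-point reduction needs a range of positive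
    length. *)
Theorem markov_hoeffding f lo hi delta :
  measurable_fun setT f -> (forall x, lo <= f x <= hi) ->
  0 < delta -> delta < 1 ->
  ((1 - delta)%:E <= P [set o | (E f - empirical_mean X f o <=
     (Num.sqrt N%:R)^-1 * eps_rate lo hi l (ln (1 / delta)))%R])%E.
Proof.
move=> mf flh d0 d1; set L := ln (1 / delta).
have bf : bounded_mfun f by exact: bounded_mfun_itv mf flh.
have L0 : 0 < L by rewrite ln_gt0// ltr_pdivlMr// mul1r.
have n0 : 0 < N%:R :> R by rewrite ltr0n.
pose nn : R := Num.sqrt N%:R.
have nn0 : 0 < nn by rewrite sqrtr_gt0.
have nnE : nn ^+ 2 = N%:R by rewrite sqr_sqrtr// ltW.
pose kap := (1 + l) / (1 - l).
have kap0 : 0 < kap by rewrite divr_gt0 ?subr_gt0// ltr_wpDr.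
pose q := Num.sqrt (2 * kap * L).
have q0 : 0 < q by rewrite sqrtr_gt0 2?mulr_gt0.
have qE : q ^+ 2 = 2 * kap * L by rewrite sqr_sqrtr// ltW// 2?mulr_gt0.
have epsE : nn^-1 * eps_rate lo hi l L = (hi - lo) / 2 * q / nn.
  by rewrite /eps_rate /q /kap [2 * (_ / _)]mulrA mulrC.
rewrite -/nn epsE.
have pt : T by exact: point.
have : lo <= hi by have /andP[h1 h2] := flh pt; exact: le_trans h1 h2.
rewrite le_eqVlt => /predU1P[lohi|lohi].
  rewrite (_ : [set _ | _] = setT) ?P1 ?lee_fin; first by lra.
  apply/seteqP; split => // o _ /=.
  have fE x : f x = lo by apply/eqP; rewrite eq_le andbC; rewrite {2}lohi.
  rewrite /empirical_mean; under eq_bigr do rewrite fE.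
  under eq_Rintegral do rewrite fE.
  rewrite (bRintegral_cst mu1) sumr_const card_ord -[lo *+ N]mulr_natl mulKf ?gt_eqF//.
  by rewrite lohi !subrr !mul0r.
pose D := hi - lo; have D0 : 0 < D by rewrite subr_gt0.
(* the minimiser of [- t c + N kap (t D) ^ 2 / 8], where [c = nn D q / 2] is the
   deviation of the sum to be exceeded *)
pose t := 2 * q / (kap * nn) / D.
have t0 : 0 < t by do 2?apply: divr_gt0 => //; apply: mulr_gt0.
pose g x := t * (E f - f x).
have bEf := bounded_mfun_cst T (E f).
have bg : bounded_mfun g by apply: bounded_mfunZ; exact: bounded_mfunB.
have gab x : t * (E f - hi) <= g x <= t * (E f - lo).
  by have /andP[? ?] := flh x; rewrite !ler_pM2l// !lerB.
have Eg : E g = 0.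
  rewrite (bRintegralZ mu1); last exact: bounded_mfunB.
  by rewrite (bRintegralB mu1)// (bRintegral_cst mu1) subrr mulr0.
have := @chain_mgf_le (t * (E f - hi)) (t * (E f - lo)) g _ bg gab Eg.
rewrite ltr_pM2l// ltrD2l ltrN2 => /(_ lohi).
rewrite (_ : t * (E f - lo) - t * (E f - hi) = t * D); last by rewrite /D; ring.
rewrite -/kap.
rewrite -expRM_natl.
set M := EP (fun o => expR (\sum_(m < N) g (X m o))).
(* at this [t] the moment is at most [exp L], and exceeding the threshold means
   that the exponent exceeds [2 L] *)
have -> : N%:R * (kap * (t * D) ^+ 2 / 8) = L.
  rewrite /t divfK ?gt_eqF// -nnE.
  rewrite [LHS](_ : _ = q ^+ 2 / (2 * kap)); last by field; rewrite !gt_eqF.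
  by rewrite qE mulrC mulKf// gt_eqF// mulr_gt0.
move=> ML.
pose Y o := \sum_(m < N) g (X m o).
have bY : bounded_mfun Y by exact: bounded_chain_sum.
have YE o : Y o = t * N%:R * (E f - empirical_mean X f o).
  rewrite /Y /g -mulr_sumr sumrB sumr_const card_ord -mulrA; congr (_ * _).
  by rewrite mulrBr /empirical_mean mulVKf ?gt_eqF// -[E f *+ N]mulr_natl.
set good := [set _ | _].
have tnE : t * N%:R * (D / 2 * q / nn) = 2 * L.
  rewrite /t -nnE.
  rewrite [LHS](_ : _ = q ^+ 2 / kap); last by field; rewrite !gt_eqF.
  by rewrite qE mulrAC mulfK// gt_eqF.
have goodE : good = Y @^-1` [set` `]-oo, 2 * L]].
  apply/seteqP; split => o; rewrite /good /= in_itv/= YE -tnE.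
    by rewrite ler_pM2l// mulr_gt0.
  by rewrite ler_pM2l// mulr_gt0.
have mgood : measurable good.
  by rewrite goodE -[X in measurable X]setTI; case: bY => mY _; exact: mY.
suff : (P (~` good) <= delta%:E)%E.
  rewrite probability_setC// EFinB.
  rewrite leeBlDr ?fin_num_measure// => h; rewrite leeBlDr//.
  by rewrite addeC.
pose I o : R := \1_(~` good) o.
have bI : bounded_mfun I.
  split; first by apply: measurable_indic; exact: measurableC.
  by exists 1 => o; rewrite /I indicE ger0_norm// lern1 leq_b1.
have -> : P (~` good) = (EP I)%:E.
  rewrite (EFin_Rintegral P1 bI) integral_indic ?setIT//; exact: measurableC.
have be : bounded_mfun (fun o => expR (- (2 * L)) * expR (Y o)).
  by apply: bounded_mfunZ; exact: bounded_mfun_expR.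
rewrite lee_fin.
apply: le_trans (le_bRintegral P1 bI be _) _.
  move=> o; rewrite -expRD /I indicE; case: (boolP (o \in _)) => [|_]; last exact: expR_ge0.
  rewrite inE goodE /= in_itv/= => /negP; rewrite -ltNge => h.
  rewrite -[leLHS]expR0 ler_expR addrC subr_ge0. exact: ltW.
rewrite (bRintegralZ P1); last exact: bounded_mfun_expR.
apply: le_trans (ler_wpM2l (expR_ge0 _) ML) _.
rewrite -expRD (_ : - (2 * L) + L = - L); last by ring.
by rewrite expRN lnK ?posrE ?divr_gt0// div1r invrK.
Qed.

End hoeffding.

(** * Losses bounded on the support *)

Section support.
Context d d' (Om : measurableType d) (T : measurableType d') (R : realType).
Variables (P : probability Om R) (N : nat) (mu : probability T R).
Variables (k : 'I_N -> R.-pker T ~> T) (X : 'I_N -> {mfun Om >-> T}).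
Variables (lam : 'I_N -> R).
Hypothesis N_gt0 : (0 < N)%N.
Hypothesis chainX : markov_chain P mu k X.
Hypothesis inv : forall i, invariant_law (k i) mu.
Hypothesis opnorm_k : forall i, opnorm_L2_0 mu (k i) = (lam i)%:E.
Hypothesis lam0 : forall i, 0 <= lam i.
Hypothesis lam1 : forall i, lam i < 1.

(** The loss is truncated to [[lo, hi]].  By stationarity every state lies in [S]
    almost surely, so neither the empirical mean nor the expectation changes. *)
Lemma markov_hoeffding_support (S : set T) (f : T -> R) lo hi delta :
  measurable S -> mu S = 1%E -> measurable_fun setT f ->
  (forall x, S x -> lo <= f x <= hi) -> 0 < delta -> delta < 1 ->
  ((1 - delta)%:E <=
   P [set o | 'E_mu[f] - (empirical_mean X f o)%:E <=
     ((Num.sqrt N%:R)^-1 *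
      eps_rate lo hi (\big[Num.max/0]_(i < N) lam i) (ln (1 / delta)))%:E])%E.
Proof.
move=> mS muS mf fS d0 d1; set l := \big[_/_]_(_ < _) _.
have laml i : lam i <= l by rewrite /l (le_bigmax _ lam).
have l0 : 0 <= l by exact: le_trans (lam0 (Ordinal N_gt0)) (laml _).
have l1 : l < 1 by rewrite /l; apply: bigmax_lt.
have contr i h : bounded_mfun h -> \int[mu]_x h x = 0 ->
    \int[mu]_x (kernel_mean (k i) h x ^+ 2) <= l ^+ 2 * \int[mu]_x (h x ^+ 2).
  move=> bh Eh.
  apply: le_trans (opnorm_L2_0_contraction (opnorm_k i) bh Eh) _.
  rewrite ler_wpM2r//; first by apply: Rintegral_ge0 => x _; exact: sqr_ge0.
  by rewrite ler_sqr ?nnegrE.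
have mSC : measurable (~` S) by exact: measurableC.
have muSC : mu (~` S) = 0%E by rewrite probability_setC// muS subee.
have [x0 Sx0] : S !=set0.
  apply/set0P/negP => /eqP S0; move: muS; rewrite S0 measure0 => /esym/eqP.
  by rewrite onee_eq0.
have lohi : lo <= hi by have /andP[h1 h2] := fS _ Sx0; exact: le_trans h1 h2.
pose g x := Num.max lo (Num.min hi (f x)).
have mg : measurable_fun setT g.
  by apply: measurable_maxr => //; exact: measurable_minr.
have glh x : lo <= g x <= hi.
  by rewrite /g le_max lexx/= ge_max lohi ge_min lexx.
have fg x : S x -> f x = g x.
  by move=> /fS /andP[lf fh]; rewrite /g (min_idPr fh) (max_idPr lf).
have bg : bounded_mfun g by exact: bounded_mfun_itv mg glh.
have fgae : ae_eq mu setT (EFin \o f) (EFin \o g).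
  exists (~` S); split => // x /= /not_implyP[_ h] Sx; apply: h.
  by rewrite fg.
have Ef : ('E_mu[f] = (\int[mu]_x g x)%:E)%E.
  rewrite unlock (EFin_Rintegral (probability_setT mu) bg).
  by apply: ae_eq_integral => //; apply/measurable_EFinP.
pose Bad := \big[setU/set0]_(m < N) (X m @^-1` (~` S)).
have [mBad PBad] : measurable Bad /\ P Bad = 0%E.
  apply: (big_ind (fun B => measurable B /\ P B = 0%E)).
  - by split => //; rewrite measure0.
  - move=> A B [mA PA] [mB PB]; split; first exact: measurableU.
    by rewrite measureU0.
  - move=> m _; split; first exact: measurable_funPTI.
    by rewrite (marginal_law chainX inv).
have memX o m : ~ Bad o -> S (X m o).
  move=> nB; apply: contrapT => nS; apply: nB.
  by rewrite /Bad (bigD1 m)//=; left.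
rewrite Ef; set c := _ * _.
have := markov_hoeffding N_gt0 chainX inv l0 l1 contr mg glh d0 d1.
rewrite -/c; set G := [set _ | _]; set F := [set _ | _] => h.
have mexp (p : T -> R) : measurable_fun setT p ->
    measurable [set o | \int[mu]_x g x - empirical_mean X p o <= c].
  move=> mp; have mY : measurable_fun setT
      (fun o => \int[mu]_x g x - empirical_mean X p o).
    apply: measurable_funB => //; apply: measurable_funM => //.
    by apply: measurable_sum => m; exact: measurableT_comp.
  rewrite (_ : [set _ | _] = setT `&`
      (fun o => \int[mu]_x g x - empirical_mean X p o) @^-1` [set` `]-oo, c]]).
    exact: mY.
  by rewrite setTI; apply/seteqP; split => o; rewrite /= in_itv.
have mG : measurable G by exact: mexp.
have mF : measurable F.
  rewrite (_ : F = [set o | \int[mu]_x g x - empirical_mean X f o <= c]).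
    exact: mexp.
  by apply/seteqP; split => o; rewrite /F/= -EFinB lee_fin.
apply: le_trans h _.
have -> : P G = P (G `\` Bad).
  rewrite (measureDI _ mG mBad) [X in (_ + X)%E](_ : _ = 0%E) ?adde0//.
  apply/eqP; rewrite eq_le measure_ge0 andbT -PBad le_measure ?inE//.
  exact: measurableI.
apply: le_measure; rewrite ?inE//; first exact: measurableD.
move=> o [Go nB]; rewrite /F /= -EFinB lee_fin.
move: Go; rewrite /G /= /empirical_mean.
rewrite (eq_bigr (fun m => f (X m o)))// => m _.
by rewrite fg//; exact: memX.
Qed.
End support.

Lemma measurable_fun_continuous_borelV (R : realType) n (f : 'cV[R]_n -> R) :
  continuous f -> measurable_fun [set: borelV R n] (f : borelV R n -> R).
Proof.
move=> cf; apply: (measurability _ (RGenOInfty.measurableE R)) => // _ [_ [x ->] <-].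
rewrite setTI; apply: sub_sigma_algebra.
by apply: open_comp => // *; exact: cf.
Qed.

Lemma measurable_loss (R : realType) (Dx Dxi J : nat)
    (a : 'I_J.+1 -> 'cV[R]_Dx -> 'cV[R]_Dxi) (b : 'I_J.+1 -> 'cV[R]_Dx -> R) z :
  measurable_fun [set: borelV R Dxi] (loss a b z : borelV R Dxi -> R).
Proof.
have mpiece j : measurable_fun [set: borelV R Dxi]
    (loss_piece a b j z : borelV R Dxi -> R).
  rewrite /loss_piece; under eq_fun do rewrite mxE.
  apply: measurable_funD => //; apply: measurable_sum => i.
  apply: measurable_funM => //.
  exact: (measurable_fun_continuous_borelV (@coord_continuous R Dxi 1 i ord0)).
rewrite /loss; elim: (index_enum _) => [|j s ih].
  by under eq_fun do rewrite big_nil; exact: mpiece.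
by under eq_fun do rewrite big_cons; exact: measurable_maxr.
Qed.

Theorem proposition4 (R : realType) (Dx Dxi J N : nat)
    (XX : set 'cV[R]_Dx)
    (XX_compact : compact XX)
    (XX_convex : convex_set (XX : set (convex_lmodType 'cV[R]_Dx)))
    (Xi : set (borelV R Dxi)) (Xi_meas : measurable Xi)
    (a : 'I_J.+1 -> 'cV[R]_Dx -> 'cV[R]_Dxi) (b : 'I_J.+1 -> 'cV[R]_Dx -> R^o)
    (a_affine : forall j, affine (a j)) (b_affine : forall j, affine (b j))
    (lo hi : R)
    (loss_bounded : forall z xi, XX z -> Xi xi -> lo <= loss a b z xi <= hi)
    (Pstar : probability (borelV R Dxi) R) (Pstar_Xi : Pstar Xi = 1%E)
    (d : measure_display) (Om : measurableType d) (P : probability Om R)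
    (N_gt0 : (0 < N)%N)
    (xihat : 'I_N -> {mfun Om >-> borelV R Dxi}) :
  (* time-homogeneous chains *)
  (forall (k : R.-pker (borelV R Dxi) ~> (borelV R Dxi)) (lam : R),
     invariant_law k Pstar ->
     markov_chain P Pstar (fun=> k) xihat ->
     opnorm_L2_0 Pstar k = lam%:E -> 0 <= lam -> lam < 1 ->
     forall (delta : R), 0 < delta -> delta < 1 ->
     forall z, XX z ->
     ((1 - delta)%:E <=
      P [set w | ('E_Pstar[loss a b z] - (empirical_mean xihat (loss a b z) w)%:E
                  <= ((Num.sqrt N%:R)^-1 * eps_rate lo hi lam (ln (1 / delta)))%:E)%E])%E)
  /\
  (* time-inhomogeneous chains *)
  (forall (k : 'I_N -> R.-pker (borelV R Dxi) ~> (borelV R Dxi)) (lam : 'I_N -> R),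
     (forall i, invariant_law (k i) Pstar) ->
     markov_chain P Pstar k xihat ->
     (forall i, opnorm_L2_0 Pstar (k i) = (lam i)%:E) ->
     (forall i, 0 <= lam i) -> (forall i, lam i < 1) ->
     forall (delta : R), 0 < delta -> delta < 1 ->
     forall z, XX z ->
     ((1 - delta)%:E <=
      P [set w | ('E_Pstar[loss a b z] - (empirical_mean xihat (loss a b z) w)%:E
                  <= ((Num.sqrt N%:R)^-1 *
                      eps_rate lo hi (\big[Num.max/0]_(i < N) lam i)
                        (ln (1 / delta)))%:E)%E])%E).
Proof.
have inhom (k : 'I_N -> R.-pker (borelV R Dxi) ~> (borelV R Dxi)) (lam : 'I_N -> R) :
    (forall i, invariant_law (k i) Pstar) ->
    markov_chain P Pstar k xihat ->
    (forall i, opnorm_L2_0 Pstar (k i) = (lam i)%:E) ->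
    (forall i, 0 <= lam i) -> (forall i, lam i < 1) ->
    forall (delta : R), 0 < delta -> delta < 1 ->
    forall z, XX z ->
    ((1 - delta)%:E <=
      P [set w | ('E_Pstar[loss a b z] - (empirical_mean xihat (loss a b z) w)%:E
                  <= ((Num.sqrt N%:R)^-1 *
                      eps_rate lo hi (\big[Num.max/0]_(i < N) lam i)
                        (ln (1 / delta)))%:E)%E])%E.
  move=> inv chain norm lam0 lam1 delta d0 d1 z XXz.
  apply: (markov_hoeffding_support N_gt0 chain inv norm lam0 lam1 Xi_meas
    Pstar_Xi (measurable_loss a b z) _ d0 d1) => xi Xixi.
  exact: loss_bounded.
split=> // k lam inv chain norm lam0 lam1 delta d0 d1 z XXz.
have := inhom (fun=> k) (fun=> lam) (fun=> inv) chain (fun=> norm) (fun=> lam0)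
  (fun=> lam1) delta d0 d1 z XXz.
suff -> : \big[Num.max/0]_(i < N) lam = lam by [].
apply/eqP; rewrite eq_le; apply/andP; split; first exact: bigmax_le.
exact: (le_bigmax _ (fun=> lam) (Ordinal N_gt0)).
Qed.
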